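(* Let $\mathcal{D} = \{(T_\theta, f_\theta) : \theta \in \Theta\}$ be a continuous family of dynamical models on a compact metric space $\mathcal{X}$, and let $\ell : \mathbb{R} \times \mathbb{R} \to [0,\infty)$ be a (jointly) lower semicontinuous loss function. Let $\mathbf{Y} = (Y_k)_{k \geq 0}$ be a real-valued stationary ergodic process satisfying $$\mathbb{E}\Bigl[\sup_{|u| \leq K_{\mathcal{D}}} \ell(u, Y_0)\Bigr] < \infty .$$ Then $\Theta_\ell(\mathbf{Y})$ is non-empty and compact, and (1) any sequence $\{\hat{\theta}_n = \theta_n(Y_0, \ldots, Y_{n-1})\}_{n\ge 1}$ of minimum risk estimators converges almost surely to the set $\Theta_\ell(\mathbf{Y})$; (2) for each $\theta \in \Theta_\ell(\mathbf{Y})$, there exists a sequence of minimum risk estimators that converges almost surely to $\theta$.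
   Context: **Dynamical models.** Let $\mathcal{X}$ be a (nonempty) compact metric space. A continuous family of dynamical models on $\mathcal{X}$ is an indexed family $\mathcal{D} = \{(T_\theta, f_\theta) : \theta \in \Theta\}$ of maps $T_\theta : \mathcal{X} \to \mathcal{X}$ and $f_\theta : \mathcal{X} \to \mathbb{R}$ such that $\Theta$ is a (nonempty) compact metric space, the map $(\theta, x) \mapsto T_\theta(x)$ from $\Theta \times \mathcal{X}$ to $\mathcal{X}$ is continuous, and the map $(\theta,x) \mapsto f_\theta(x)$ from $\Theta \times \mathcal{X}$ to $\mathbb{R}$ is continuous. $K_{\mathcal{D}} > 0$ denotes a constant with $|f_\theta(x)| \leq K_{\mathcal{D}}$ for all $\theta \in \Theta$, $x \in \mathcal{X}$. $T_\theta^k$ is the $k$-fold composition of $T_\theta$ ($T_\theta^0 = \mathrm{Id}$). **Associated processes.** $\mathcal{M}(\mathcal{X}, T_\theta)$ is the set of Borel probability measures on $\mathcal{X}$ invariant under $T_\theta$. $\mathcal{Q}_\theta$ is the set of stationary processes $\mathbf{U} = (f_\theta \circ T_\theta^k(X))_{k \geq 0}$ with $X \sim \mu$, $\mu \in \mathcal{M}(\mathcal{X},T_\theta)$. Processes are identified with their laws on $\mathbb{R}^{\mathbb{N}}$, $\mathbb{N} = \{0,1,2,\dots\}$. **Joinings and distortion.** A joining of stationary processes $\mathbf{U}$, $\mathbf{V}$ is a stationary process $((\tilde U_k, \tilde V_k))_{k \geq 0}$ such that $(\tilde U_k)_k$ has the law of $\mathbf{U}$ and $(\tilde V_k)_k$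 has the law of $\mathbf{V}$; $\mathcal{J}(\mathbf{U},\mathbf{V})$ is the set of all joinings. For a nonnegative loss $L : \mathbb{R} \times \mathbb{R} \to \mathbb{R}$, $\gamma_L(\mathbf{U},\mathbf{V}) = \inf_{\mathcal{J}(\mathbf{U},\mathbf{V})} \mathbb{E}[L(U_0,V_0)]$, and $$\Theta_L(\mathbf{Y}) = \operatorname*{argmin}_{\theta \in \Theta} \ \min_{\mathbf{U} \in \mathcal{Q}_\theta} \gamma_L(\mathbf{U},\mathbf{Y}).$$ **Minimum risk estimators.** For $\theta \in \Theta$, $x \in \mathcal{X}$, let $R_n(\theta : x) = \frac1n \sum_{k=0}^{n-1} \ell(f_\theta \circ T_\theta^k(x), Y_k)$. A sequence of measurable functions $\theta_n : \mathbb{R}^n \to \Theta$, $n \geq 1$, with $\hat\theta_n := \theta_n(Y_0, \ldots, Y_{n-1})$, is a sequence of (empirical) minimum risk estimates/estimators for $\mathcal{D}$ if, with probability one, the limit on the left below exists and $$\lim_n \inf_{x} R_n(\hat\theta_n : x) = \lim_n \inf_\theta \inf_x R_n(\theta : x).$$ (The limit on the right exists almost surely.) If the supremum in the integrability condition is not measurable, the expectation is an outer expectation. Convergence of $\hat\theta_n$ to a set means that the distance from $\hat\theta_n$ to the set tends to $0$. *)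

(* Defs.v *)
From HB Require Import structures.
From mathcomp Require Export all_boot all_order all_algebra.
From mathcomp Require Export all_classical all_reals all_analysis.
From mathcomp Require Export measurable_realfun.

Set Implicit Arguments.
Unset Strict Implicit.
Unset Printing Implicit Defensive.

Import Order.TTheory GRing.Theory Num.Theory.
Export numFieldNormedType.Exports.

Local Open Scope classical_set_scope.
Local Open Scope ring_scope.

(* Nonempty metric spaces: the library's measurable types are pointed, so
   non-emptiness has to be provided as structure to have a Borel sigma-algebra. *)
#[short(type="pmetricType")]
HB.structure Definition PointedMetric (K : numDomainType) :=
  { M of Metric K M & isPointed M }.

Notation borel X := (g_sigma_algebraType (@open X)).

Definition cylinders d (T : measurableType d) : set (set (nat -> T)) :=
  [set A | exists k (B : set T), measurable B /\ A = [set u | B (u k)]].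

(* Generated by the coordinates, this is the product sigma-algebra. *)
Notation seqspace T := (g_sigma_algebraType (@cylinders _ T)).

Section sequence_space.
Context d (T : measurableType d) (R : realType).

Definition shift (u : seqspace T) : seqspace T := fun k => u k.+1.

Definition stationary (Q : probability (seqspace T) R) : Prop :=
  forall A : set (seqspace T), measurable A -> pushforward Q shift A = Q A.

Definition ergodic (Q : probability (seqspace T) R) : Prop :=
  forall A : set (seqspace T), measurable A -> shift @^-1` A = A ->
    Q A = 0%E \/ Q A = 1%E.

End sequence_space.

Section process_law.
Context d (Omega : measurableType d) (R : realType) (P : probability Omega R).
Context d' (T : measurableType d').
Implicit Type Y : nat -> {RV P >-> T}.

Definition path_of Y : Omega -> seqspace T := fun w k => Y k w.

Lemma measurable_path_of Y : measurable_fun [set: Omega] (path_of Y).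
Proof.
apply: (@measurability _ _ Omega (seqspace T) _ _ (@cylinders _ T)) => //.
move=> _ [_ [k [B [mB ->]] <-]].
by rewrite setTI; exact: measurable_funPTI.
Qed.

HB.instance Definition _ Y :=
  isMeasurableFun.Build _ _ _ _ (path_of Y) (measurable_path_of Y).

Definition process_law Y : probability (seqspace T) R :=
  distribution P (path_of Y).

End process_law.

Section joinings.
Context (R : realType).
Implicit Types U V : probability (seqspace R) R.

Definition joinings U V : set (probability (seqspace (R * R)%type) R) :=
  [set J | [/\ stationary J,
    (forall A : set (seqspace R), measurable A ->
       pushforward J (fun z => (fun k => (z k).1) : seqspace R) A = U A) &
    (forall A : set (seqspace R), measurable A ->
       pushforward J (fun z => (fun k => (z k).2) : seqspace R) A = V A)]].

Definition gamma (L : R * R -> R) U V : \bar R :=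
  ereal_inf [set (\int[J]_z (L (z 0%N))%:E)%E | J in joinings U V].

End joinings.

Section models.
Context (R : realType) (X Theta : pmetricType R).
Variables (T : Theta -> X -> X) (f : Theta -> X -> R).

Definition continuous_family : Prop :=
  [/\ compact [set: X], compact [set: Theta],
      continuous (fun z : Theta * X => T z.1 z.2) &
      continuous (fun z : Theta * X => f z.1 z.2)].

Definition invariant_measures (t : Theta) : set (probability (borel X) R) :=
  [set mu | forall A : set (borel X), measurable A ->
     pushforward mu (T t : borel X -> borel X) A = mu A].

Definition observations (t : Theta) (x : X) : seqspace R :=
  fun k => f t (iter k (T t) x).

Definition processes (t : Theta) : set (probability (seqspace R) R) :=
  [set U | exists2 mu, invariant_measures t mu &
     forall A : set (seqspace R), measurable A ->
       U A = pushforward mu (observations t : borel X -> seqspace R) A].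

Definition min_gamma (L : R * R -> R) (V : probability (seqspace R) R)
    (t : Theta) : \bar R :=
  ereal_inf [set gamma L U V | U in processes t].

(* The first conjunct says that the infimum in [min_gamma] is attained at [t],
   i.e. that it is a minimum. *)
Definition optimal_parameters (L : R * R -> R)
    (V : probability (seqspace R) R) : set Theta :=
  [set t | (exists2 U, processes t U & gamma L U V = min_gamma L V t) /\
           forall t', (min_gamma L V t <= min_gamma L V t')%E].

Definition empirical_risk (l : R * R -> R) (y : nat -> R) (n : nat)
    (t : Theta) (x : X) : R :=
  n%:R^-1 * \sum_(k < n) l (f t (iter k (T t) x), y k).

End models.

Section estimators.
Context (R : realType) (X Theta : pmetricType R).
Variables (T : Theta -> X -> X) (f : Theta -> X -> R) (l : R * R -> R).
Context d (Omega : measurableType d) (P : probability Omega R).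
Variable Y : nat -> {RV P >-> R}.

Definition estimate (theta_ : forall n, n.-tuple R -> Theta)
    (w : Omega) (n : nat) : Theta :=
  theta_ n [tuple Y k w | k < n].

(* Only the indices [n >= 1] matter. The infima are over nonempty sets of
   nonnegative reals when [l] is nonnegative. *)
Definition min_risk_estimator (theta_ : forall n, n.-tuple R -> Theta) : Prop :=
  (forall n, (0 < n)%N ->
     measurable_fun [set: n.-tuple R] (theta_ n : n.-tuple R -> borel Theta)) /\
  {ae P, forall w,
     let risk n t := inf [set empirical_risk T f l (Y ^~ w) n t x | x in [set: X]] in
     let lhs n := risk n (estimate theta_ w n) in
     let rhs n := inf [set risk n t | t in [set: Theta]] in
     [/\ cvgn lhs, cvgn rhs & limn lhs = limn rhs]}.

End estimators.

(* The library integral of a nonnegative function is a supremum over simple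
   functions below it, hence an inner integral when the function is not
   measurable. *)
Definition outer_expectation d (Omega : measurableType d) (R : realType)
    (P : probability Omega R) (F : Omega -> \bar R) : \bar R :=
  ereal_inf [set (\int[P]_w G w)%E | G in
    [set G : Omega -> \bar R |
       measurable_fun [set: Omega] G /\ forall w, (F w <= G w)%E]].

(* Main.v *)
From HB Require Import structures.
From mathcomp Require Import ring lra.
Require Import Defs.

Set Implicit Arguments.
Unset Strict Implicit.
Unset Printing Implicit Defensive.

Import Order.TTheory GRing.Theory Num.Theory.
Local Open Scope classical_set_scope.
Local Open Scope ring_scope.

(** Let [V] be the law of [Y] and [m t] the minimal distortion between a process
    of [t] and [V].  Two facts hold for almost every path [y].

    Upper bound: for fixed [t] and [c > m t], eventually some [x] has risk at most
    [c].  Otherwise ergodicity makes the minimal total loss exceed [c n]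
    (infinitely often, by any amount) for almost every path; along a joining of
    cost less than [c] whose first coordinate is an orbit, this contradicts the
    maximal inequality.

    Lower bound: if the frequencies of a countable generating algebra of cylinders
    along [y] converge to their probabilities and [r < m t], then eventually all
    risks at parameters near [t] exceed [r].  Otherwise an ultrafilter limit of the
    empirical measures of [(t', T^k x, shift^k y)] is a finitely additive set
    function; compactness of [Theta * X] turns it into an invariant measure, whose
    image is a joining of [V] with a process of [t], and lower semicontinuity of
    the loss bounds the cost of that joining by [r].

    Compactness of [Theta] makes the lower bound uniform, and everything follows. *)

(** * Measures dominated by a finitely additive set function *)

(** The path space is not compact, paths are generic only for countably many cylinders, and the loss
    is merely lower semicontinuous, so the limit set function is compared with a measure from one
    side only. The outer measure generated by rectangles with an open side in [Theta * X] and a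
    cylinder side stays below it on countable unions of rectangles, and superlevel sets of the loss
    are such unions. No mass is lost: fibres are compact, and in the path direction countable
    additivity is inherited from [V].

    Lower semicontinuity gives no upper bound on limits of averages, and a joining need not be
    ergodic. The upper bound therefore uses ergodicity of [V] alone: the loss being nonnegative, the
    event of unbounded excess is shift invariant up to a null set and obeys a zero-one law.

    The null set of the upper bound depends on the parameter, so that bound is applied to countably
    many parameters fixed before the path. The lower bound holds at all parameters along each
    generic path. Integrability of the loss makes [m] finite. *)

Section probability_pushforward.
Context d d' (T1 : measurableType d) (T2 : measurableType d') (R : realType).
Variables (m : {measure set T1 -> \bar R}) (phi : T1 -> T2).
Hypotheses (mphi : measurable_fun setT phi) (m1 : m setT = 1%E).

(* The proof arguments let canonical structures find the probability instance. *)
Definition image_law of measurable_fun setT phi & m setT = 1%E := pushforward m phi.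
Local Notation Q := (image_law mphi m1).

Let Q0 : Q set0 = 0%E.
Proof. by rewrite /image_law /pushforward preimage_set0 measure0. Qed.

Let Q_ge0 A : (0 <= Q A)%E.
Proof. exact: measure_ge0. Qed.

Let mP : {mfun T1 >-> T2} := HB.pack phi (isMeasurableFun.Build _ _ _ _ phi mphi).

Let Q_sigma_additive : semi_sigma_additive Q.
Proof. exact: (@measure_semi_sigma_additive _ _ _ (pushforward m mP)). Qed.

HB.instance Definition _ := isMeasure.Build _ _ _ Q Q0 Q_ge0 Q_sigma_additive.

Let Q1 : Q setT = 1%E.
Proof. by rewrite /image_law /pushforward preimage_setT. Qed.

HB.instance Definition _ := Measure_isProbability.Build _ _ _ Q Q1.

Lemma ge0_integral_image_law (g : T2 -> \bar R) : measurable_fun setT g ->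
  (forall u, 0 <= g u)%E -> (\int[Q]_u g u = \int[m]_v g (phi v))%E.
Proof.
move=> mg g0; rewrite -(@ge0_integral_pushforward _ _ _ _ _ mP _ m setT)//.
Qed.

End probability_pushforward.

Lemma le_measure_ae d (T : measurableType d) (R : realType)
    (m : {measure set T -> \bar R}) (A B : set T) :
  measurable A -> measurable B -> {ae m, forall v, A v -> B v} -> (m A <= m B)%E.
Proof.
move=> mA mB [N [mN N0 ABN]]; apply: (@le_trans _ _ (m (B `|` N))).
  apply: le_measure; rewrite ?inE//; first exact: measurableU.
  move=> v Av; have [Bv|nBv] := pselect (B v); [by left|right].
  by apply: ABN => /= h; apply: nBv; exact: h.
apply: le_trans (_ : (m B + m N <= _)%E); first exact: measureU2.
by rewrite N0 adde0.
Qed.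

Lemma eq_measure_ae d (T : measurableType d) (R : realType)
    (m : {measure set T -> \bar R}) (A B : set T) :
  measurable A -> measurable B -> {ae m, forall v, A v <-> B v} -> m A = m B.
Proof.
move=> mA mB AB; apply/eqP; rewrite eq_le !le_measure_ae//;
  by apply: filterS AB => v [].
Qed.

Section content_extension.
Context (R : realType) (W : ptopologicalType) d (Om : measurableType d).
Variables (V : probability Om R) (AA : set_system Om) (nu : set (W * Om) -> R).
Hypothesis cptW : compact [set: W].
Hypothesis open_superlevel : forall O : set W, open O ->
  exists2 h : W -> \bar R, continuous h & O = [set w | (0 < h w)%E].
Hypotheses (AA_T : AA setT) (AA_I : setI_closed AA) (AA_C : setC_closed AA).
Hypotheses (AA_measurable : AA `<=` measurable)
  (AA_generates : @measurable _ Om `<=` <<s AA >>).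
Hypotheses (nu_ge0 : forall E, 0 <= nu E)
  (nuU : forall E F, E `&` F = set0 -> nu (E `|` F) = nu E + nu F)
  (nuV : forall B, AA B -> (nu (setT `*` B))%:E = V B).

Let AA_U A B : AA A -> AA B -> AA (A `|` B).
Proof.
move=> hA hB; rewrite -[A `|` B]setCK setCU.
by apply: AA_C; apply: AA_I; exact: AA_C.
Qed.

Let AA_0 : AA set0.
Proof. by rewrite -setCT; exact: AA_C. Qed.

Let nu0 : nu set0 = 0.
Proof.
have := nuU (setI0 (@set0 (W * Om))); rewrite setU0 => /eqP.
by rewrite -subr_eq0 opprD addrA subrr sub0r oppr_eq0 => /eqP.
Qed.

Let nu_split E H : nu E = nu (E `&` H) + nu (E `\` H).
Proof.
by rewrite -nuU ?setUIDK// -subset0 => x [[_ ?] []].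
Qed.

Let nu_le E F : E `<=` F -> nu E <= nu F.
Proof. by move=> EF; rewrite (nu_split F E) setIidr// lerDl. Qed.

Let nuU_le E F : nu (E `|` F) <= nu E + nu F.
Proof.
rewrite (nu_split (E `|` F) E) setUK setDUl setDv set0U lerD2l.
exact: nu_le.
Qed.

Let nu_sum_le (F : nat -> set (W * Om)) n E :
  E `<=` \bigcup_(k < n) F k -> nu E <= \sum_(k < n) nu (F k).
Proof.
elim: n E => [|n IHn] E.
  by rewrite big_ord0 => EF; rewrite (_ : E = set0) ?nu0// -subset0 => x /EF[].
move=> EF; rewrite big_ord_recr/=.
apply: (@le_trans _ _ (nu ((E `\` F n) `|` F n))).
  by apply: nu_le; rewrite setDE setUIl setUCl setIT; left.
apply: (le_trans (nuU_le _ _)); rewrite lerD2r; apply: IHn => x [/EF[k /= kn Fkx] nFx].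
exists k => //=; move: kn; rewrite ltnS leq_eqVlt => /orP[/eqP kn|//].
by rewrite kn in Fkx.
Qed.

(** Open first sides let compactness of [W] select finite subcovers; second sides in [AA] are the
    sets on which the marginal of [nu] is known to be [V]. *)
Let rectangles : set_system (W * Om) :=
  [set E | exists O B, [/\ open O, AA B & E = O `*` B]].

(* On the discrete sigma-algebra the library's [mu_ext] minimizes over all
   countable covers; the weight [+oo] leaves only the covers by rectangles. *)
Let T0 := g_sigma_algebraType [set: set (W * Om)].

Let weight (E : set T0) : \bar R :=
  if `[< rectangles E >] then (nu E)%:E else +oo%E.

Let weight0 : weight set0 = 0%E.
Proof.
rewrite /weight; case: asboolP => [|[]]; first by rewrite nu0.
by exists set0, set0; split => //; [exact: open0|rewrite setX0].
Qed.

Let weight_ge0 E : (0 <= weight E)%E.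
Proof. by rewrite /weight; case: asboolP => // _; rewrite lee_fin. Qed.

Let weightE O B : open O -> AA B -> weight (O `*` B) = (nu (O `*` B))%:E.
Proof. by move=> oO AB; rewrite /weight asboolT//; exists O, B. Qed.

Let mext : set T0 -> \bar R := mu_ext weight.

Let outer : {outer_measure set T0 -> \bar R} := HB.pack mext
  (isOuterMeasure.Build R T0 mext (mu_ext0 weight0 weight_ge0)
    (mu_ext_ge0 weight_ge0) (le_mu_ext weight)
    (mu_ext_sigma_subadditive weight_ge0)).

Let mext_rect O B : open O -> AA B -> (outer (O `*` B) <= (nu (O `*` B))%:E)%E.
Proof.
move=> oO AB; apply: ereal_inf_lbound => /=.
exists (fun k => if k is 0%N then O `*` B else set0).
  split; last by move=> x ?; exists 0%N.
  by move=> i; exact: sub_sigma_algebra.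
rewrite nneseries_recl//.
by rewrite weightE// eseries0 ?adde0// => -[].
Qed.

(** The set is a finite Boolean combination of the [B_ k]. Letting [P] vary carries the induction:
    over a point of [B_ n], only the part of [P] outside [U_ n] is left to the earlier
    rectangles. *)
Let section_cover (U_ : nat -> set W) (B_ : nat -> set Om) (P : set W) n :
  (forall k, AA (B_ k)) ->
  AA [set w | forall x, P x -> exists2 k, (k < n)%N & U_ k x /\ B_ k w].
Proof.
move=> AB; elim: n P => [|n IHn] P.
  have [[x Px]|nP] := pselect (P !=set0).
    rewrite (_ : mkset _ = set0)//.
    by rewrite -subset0 => w /(_ x Px)[k]; rewrite ltn0.
  rewrite (_ : mkset _ = setT)// -subTset => w _ x Px.
  by exfalso; apply: nP; exists x.
rewrite (_ : mkset _ =
   (B_ n `&` [set w | forall x, (P `\` U_ n) x ->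
      exists2 k, (k < n)%N & U_ k x /\ B_ k w]) `|`
   [set w | forall x, P x -> exists2 k, (k < n)%N & U_ k x /\ B_ k w]).
  by apply: AA_U => //; exact: AA_I.
apply/seteqP; split => w /=.
  move=> h; have [Bnw|nBnw] := pselect (B_ n w); [left; split => //|right].
    move=> x [/h[k + [Okx Bkw]] nOx]; rewrite ltnS leq_eqVlt => /orP[/eqP kn|kn].
      by rewrite kn in Okx.
    by exists k.
  move=> x /h[k + [Okx Bkw]]; rewrite ltnS leq_eqVlt => /orP[/eqP kn|kn].
    by rewrite kn in Bkw.
  by exists k.
case=> [[Bnw h] x Px|h x /h[k kn ?]]; last by exists k => //; exact: ltnW.
have [Ox|nOx] := pselect (U_ n x); first by exists n.
by have [k kn ?] := h x (conj Px nOx); exists k => //; exact: ltnW.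
Qed.

(* Each fibre over [Om] is compact, so finitely many rectangles cover it; the set
   of points whose fibre is covered by the first [n] increases to [Om]. *)
Let cover_weight_ge1 (F : nat -> set T0) :
  [set: W * Om] `<=` \bigcup_k F k -> (1 <= \sum_(k <oo) weight (F k))%E.
Proof.
move=> TF; have [[k nFk]|] := pselect (exists k, ~ rectangles (F k)).
  rewrite (@eseries_pinfty _ _ _ k) ?leey//.
    by move=> n _; rewrite -ltNye (lt_le_trans _ (weight_ge0 _)).
  by rewrite /weight asboolF.
move=> /forallNP nF.
have : forall k, rectangles (F k) by move=> k; apply: contrapT; exact: nF.
move=> /choice[U_ /choice[B_ FE]].
have oO k : open (U_ k) by case: (FE k).
have AB k : AA (B_ k) by case: (FE k).
pose C n := [set w | forall x, [set: W] x ->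
  exists2 k, (k < n)%N & U_ k x /\ B_ k w].
have AC n : AA (C n) by exact: section_cover.
have CT : \bigcup_n C n = setT.
  rewrite -subTset => w _.
  have /compact_near_coveringP := cptW.
  move=> /(_ nat \oo (fun n x => exists2 k, (k < n)%N & U_ k x /\ B_ k w)).
  move=> /(_ _)[x _|n _ h].
    have [k _] := TF (x, w) I; have [_ _ ->] := FE k => -[/= Okx Bkw].
    exists (U_ k, [set n | (k < n)%N]); first split => /=.
      exact: open_nbhs_nbhs.
    by exists k.+1.
    by move=> [y n] /= [Oky kn]; exists k.
  by exists n => // x _; apply: (h n) => //=.
have ndC : nondecreasing_seq C.
  move=> m n mn; apply/subsetPset => w Cw x Px.
  by have [k km ?] := Cw x Px; exists k => //; exact: leq_trans mn.
have mC n : measurable (C n) by exact: AA_measurable.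
have mCT : measurable (\bigcup_n C n) by exact: bigcupT_measurable.
have cvgC := nondecreasing_cvg_mu mC mCT ndC (mu := V).
rewrite -(probability_setT V) -CT -(cvg_lim _ cvgC)//.
apply: lime_le.
  apply: ereal_nondecreasing_is_cvgn => m n mn.
  by apply: le_measure; rewrite ?inE//; exact/subsetPset/ndC.
near=> n; rewrite /= -nuV//.
(* Over [C n] the first [n] rectangles cover whole fibres, so finite subadditivity of [nu] is
   enough. *)
apply: (@le_trans _ _ (\sum_(k < n) nu (F k))%:E).
  rewrite lee_fin; apply: nu_sum_le => -[x w] [_ /= /(_ x I)[k kn [Ok Bk]]].
  by exists k => //; have [_ _ ->] := FE k.
rewrite -sumEFin -(big_mkord xpredT (fun k => (nu (F k))%:E)).
apply: le_trans (nneseries_lim_ge n _); last first.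
  by move=> k _ _; exact: weight_ge0.
by apply: lee_sum => k _; have [? ? ->] := FE k; rewrite weightE.
Unshelve. all: by end_near. Qed.

(** Cover an arbitrary set and sum the hypothesis over the cover; a piece that is not a rectangle
    has weight [+oo]. *)
Let caratheodory_of_rectangles (H : set T0) :
  (forall U B, open U -> AA B ->
    (outer ((U `*` B) `&` H) + outer ((U `*` B) `&` ~` H) <=
     (nu (U `*` B))%:E)%E) -> outer.-caratheodory H.
Proof.
move=> hH; apply: le_caratheodory_measurable => X.
apply: le_ereal_inf_tmp => _ [F [_ XF] <-].
have sub K : (outer (X `&` K) <= \sum_(k <oo) outer (F k `&` K))%E.
  apply: le_trans (outer_measure_sigma_subadditive outer _).
  by apply: le_outer_measure => x [/XF[k _ Fkx] Kx]; exists k.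
apply: le_trans (leeD (sub H) (sub (~` H))) _.
rewrite -nneseriesD; [|by move=> *; exact: outer_measure_ge0..].
apply: lee_nneseries => [k _ _|k _].
  by rewrite adde_ge0 ?outer_measure_ge0.
rewrite /weight; case: asboolP => [[U [B [oU AB ->]]]|_]; last by rewrite leey.
exact: hH.
Qed.

Let caratheodory_side B : AA B -> outer.-caratheodory (setT `*` B).
Proof.
move=> AB; apply: caratheodory_of_rectangles => U B' oU AB'.
rewrite (nu_split _ (setT `*` B)) EFinD.
have -> : (U `*` B') `&` (setT `*` B) = U `*` (B' `&` B).
  by rewrite -setXI setIT.
have E : (U `*` B') `&` ~` (setT `*` B) = U `*` (B' `&` ~` B).
  apply/seteqP; split => -[x w] /=; last by move=> [? [? nB]]; split => // -[].
  by move=> [[? ?] nB]; split => //; split => // ?; exact: nB.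
rewrite setDE E; apply: leeD; apply: mext_rect => //; apply: AA_I => //.
exact: AA_C.
Qed.

(** Caratheodory's criterion for metric outer measures, with [h] in the role of the distance to the
    complement: the parts of a rectangle where [h] is above and below a level are disjoint open
    rectangles, and what is missed just above zero is covered by shells of vanishing total mass. *)
Let caratheodory_open U0 : open U0 -> outer.-caratheodory (U0 `*` setT).
Proof.
move=> /open_superlevel[h ch ->]; apply: caratheodory_of_rectangles => U B oU AB.
pose c k : R := k.+1%:R^-1.
have c_gt0 k : 0 < c k by rewrite invr_gt0.
have c_lt m n : (m < n)%N -> c n < c m.
  by move=> mn; rewrite ltf_pV2 ?posrE// ltr_nat ltnS.
have o_gt r : open [set x | (r%:E < h x)%E].
  apply: (@open_comp _ _ h [set y | r%:E < y]%E) => [x _|]; first exact: ch.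
  exact: open_ereal_gt_ereal.
have o_lt r : open [set x | (h x < r%:E)%E].
  apply: (@open_comp _ _ h [set y | y < r%:E]%E) => [x _|]; first exact: ch.
  exact: open_ereal_lt_ereal.
pose r k := nu ((U `&` [set x | (c k)%:E < h x]%E) `*` B).
(* Consecutive shells overlap, but their total mass telescopes to at most twice
   that of [U `*` B], so the tails of the series of shells are negligible. *)
pose shell k := (U `&` ([set x | (c k.+2)%:E < h x]%E `&` [set x | h x < (c k)%:E]%E)) `*` B.
have o_shell k : (outer (shell k) <= (nu (shell k))%:E)%E.
  by apply: mext_rect => //; apply: openI => //; exact: openI.
have r_le k : r k <= nu (U `*` B).
  by apply: nu_le => -[x w] /= [[]].
(* The shell and the part where [h] exceeds [c k] are disjoint, and both lie where [h] exceeds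
   [c k.+2]. *)
have shell_le k : nu (shell k) <= r k.+2 - r k.
  rewrite lerBrDr -nuU.
    apply: nu_le => -[x w] /= [|]; first by move=> [[Ux [? ?]] Bw].
    by move=> [[Ux /= ckx] ?]; split => //; split => //; apply: lt_trans ckx; rewrite lte_fin c_lt.
  rewrite -subset0 => -[x w] [] [[_ [_ /= hk]] _] [[_ /= kh] _].
  by move: (lt_trans hk kh); rewrite ltxx.
have shells_fin : (\sum_(k <oo) (nu (shell k))%:E < +oo)%E.
  apply: (@le_lt_trans _ _ (nu (U `*` B) + nu (U `*` B))%:E); last exact: ltry.
  apply: lime_le; first by apply: is_cvg_nneseries => *; rewrite lee_fin.
  apply: nearW => n; rewrite sumEFin lee_fin.
  apply: (@le_trans _ _ (r n.+1 + r n - r 0%N - r 1%N)).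
    elim: n => [|n IHn].
      by rewrite big_nil le_eqVlt; apply/orP; left; apply/eqP; ring.
    rewrite big_nat_recr//=; apply: le_trans (lerD IHn (shell_le n)) _.
    rewrite le_eqVlt; apply/orP; left; apply/eqP; ring.
  rewrite -addrA; apply: le_trans (_ : r n.+1 + r n <= _).
    by rewrite gerDl -opprD oppr_le0 addr_ge0 ?nu_ge0.
  by rewrite lerD.
have tail0 : (\sum_(j <= k <oo) (nu (shell k))%:E)%E @[j --> \oo] --> 0%E.
  by apply: nneseries_tail_cvg => // k _; rewrite lee_fin.
set pos := [set w | (0 < h w)%E].
have key j : (outer ((U `*` B) `&` (pos `*` setT)) +
    outer ((U `*` B) `&` ~` (pos `*` setT)) <=
    (nu (U `*` B))%:E + \sum_(j <= k <oo) (nu (shell k))%:E)%E.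
  (* Both sets are rectangles and they are disjoint. Points with [0 < h x <= c j.+1] are left to the
     shells from index [j] on. *)
  pose HI := (U `&` [set x | (c j.+1)%:E < h x]%E) `*` B.
  pose LO := (U `&` [set x | h x < (c j.+1)%:E]%E) `*` B.
  have -> : ((nu (U `*` B))%:E = (nu HI)%:E + (nu (U `*` B `\` HI))%:E)%E.
    rewrite (nu_split (U `*` B) HI) EFinD setIidr//.
    by move=> [x w] [[]].
  rewrite addeAC; apply: leeD.
    apply: (@le_trans _ _ (outer (HI `|` \bigcup_(k in ~` `I_j) shell k))).
      apply: le_outer_measure => -[x w] [[/= Ux Bw] [/= hx _]].
      have [hj|hj] := ltP (c j.+1)%:E (h x); [by left|right].
      (* The least [m] with [c m < h x] puts [x] in the shell of index [m - 2]. *)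
      have : exists m, ((c m)%:E < h x)%E.
        have : (0 < h x)%E := hx; case: (h x) => [r0 r00|_|//].
          have [m _ mh] := near_infty_natSinv_lt (PosNum (r00 : 0 < r0)).
          by exists m; rewrite lte_fin; exact: (mh m (leqnn m)).
        by exists 0%N; rewrite ltry.
      move=> /ex_minnP[m cm min_m].
      have jm : (j.+1 < m)%N.
        rewrite ltnNge; apply/negP => mj.
        have : ((c j.+1)%:E <= (c m)%:E)%E by rewrite lee_fin lef_pV2 ?posrE// ler_nat ltnS.
        by move=> /(le_trans hj)/(lt_le_trans cm); rewrite ltxx.
      case: m => [//|[//|m]] in cm min_m jm *.
      exists m; first by apply/negP; rewrite -leqNgt -ltnS -ltnS.
      split => //; split => //; split => //=.
      have hm1 : (h x <= (c m.+1)%:E)%E.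
        by rewrite leNgt; apply/negP => /min_m; rewrite ltnn.
      by apply: le_lt_trans hm1 _; rewrite lte_fin c_lt.
    apply: le_trans (outer_measureU2 _ _ _) _; apply: leeD.
      by apply: mext_rect => //; exact: openI.
    apply: le_trans (outer_measure_sigma_subadditive_tail _ _ _) _.
    by apply: lee_nneseries => // k _ _; exact: outer_measure_ge0.
  apply: (@le_trans _ _ (outer LO)).
    apply: le_outer_measure => -[x w] [[/= Ux Bw] nh]; split => //; split => //=.
    apply: (@le_lt_trans _ _ 0%E); last by rewrite lte_fin.
    rewrite leNgt; apply/negP => hx.
    exact: nh.
  apply: le_trans (_ : (nu LO)%:E <= _)%E.
    by apply: mext_rect => //; exact: openI.
  rewrite lee_fin; apply: nu_le => -[x w] [[/= Ux hx] Bw]; split => // -[[_ /= xh] _].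
  by move: (lt_trans hx xh); rewrite ltxx.
have : (fun j => (nu (U `*` B))%:E + \sum_(j <= k <oo) (nu (shell k))%:E)%E
    @ \oo --> ((nu (U `*` B))%:E + 0)%E.
  by apply: cvgeD => //; exact: cvg_cst.
rewrite adde0 => /cvg_lim <-//; apply: lime_ge; last exact: nearW.
apply/cvg_ex; exists ((nu (U `*` B))%:E + 0)%E.
by apply: cvgeD => //; exact: cvg_cst.
Qed.

(** The identity between two sigma-algebras on one set: its measurability says that every set of the
    product sigma-algebra is Caratheodory measurable, and the image law under it is the restriction
    of [outer]. *)
Let coordinates : caratheodory_type outer -> borel W * Om := id.

Let measurable_AAE : @measurable _ Om = <<s AA >>.
Proof.
apply/seteqP; split=> //; apply: smallest_sub AA_measurable.
exact: sigma_algebra_measurable.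
Qed.

Let measurable_coordinates : measurable_fun setT coordinates.
Proof.
apply/measurable_fun_pairP; split.
  apply: (@measurability _ _ _ (borel W) _ _ (@open W)) => // _ [U oU <-].
  rewrite setTI (_ : _ @^-1` _ = U `*` setT); first exact: caratheodory_open.
  by apply/seteqP; split => -[x w] //= [].
apply: (@measurability _ _ _ Om _ _ AA measurable_AAE) => _ [B AB <-].
rewrite setTI (_ : _ @^-1` _ = setT `*` B); first exact: caratheodory_side.
by apply/seteqP; split => -[x w] //= [].
Qed.

Let outer_setT : outer setT = 1%E.
Proof.
apply/eqP; rewrite eq_le; apply/andP; split.
  rewrite -setXTT; apply: le_trans (mext_rect openT AA_T) _.
  by rewrite nuV// probability_setT.
by apply: le_ereal_inf_tmp => _ [F [_ TF] <-]; exact: cover_weight_ge1.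
Qed.

(* Splitting along the sides [B_ n] makes the sections over each piece a single
   open set, so that the bound on rectangles applies. *)
Let outer_rectangles_split (U_ : nat -> set W) (B_ : nat -> set Om) n U B :
  (forall k, open (U_ k)) -> (forall k, AA (B_ k)) -> open U -> AA B ->
  forall E, E = (setT `*` B) `&` ((U `*` setT) `|` \bigcup_(k < n) (U_ k `*` B_ k)) ->
  (outer E <= (nu E)%:E)%E.
Proof.
move=> oU_ AB_; elim: n U B => [|n IHn] U B oU AB E EE.
  rewrite EE (_ : _ `&` _ = U `*` B); first exact: mext_rect.
  by apply/seteqP; split => -[x w] /=; [case=> -[_ ?] [[? _]//|[]]|case; do 2 ?split => //; left].
have -> : outer E = (outer (E `&` (setT `*` B_ n)) + outer (E `&` ~` (setT `*` B_ n)))%E.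
  exact: caratheodory_side.
rewrite (nu_split E (setT `*` B_ n)) EFinD.
have E1 : E `&` (setT `*` B_ n) = (setT `*` (B `&` B_ n)) `&`
    (((U `|` U_ n) `*` setT) `|` \bigcup_(k < n) (U_ k `*` B_ k)).
  rewrite EE; apply/seteqP; split => -[x w] /=.
    move=> [[[_ Bw] h] [_ Bnw]]; split => //; case: h => [[Ux _]|[k /= kn [Ukx Bkw]]].
      by left; split => //; left.
    move: kn; rewrite ltnS leq_eqVlt => /orP[/eqP kn|kn]; last by right; exists k.
    by left; split => //; right; rewrite -kn.
  move=> [[_ [Bw Bnw]] h]; split => //; split => //.
  case: h => [[[Ux|Unx] _]|[k /= kn [Ukx Bkw]]]; first by left.
    by right; exists n => //=.
  by right; exists k => //=; exact: ltnW.
have E2 : E `\` (setT `*` B_ n) = (setT `*` (B `&` ~` B_ n)) `&`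
    ((U `*` setT) `|` \bigcup_(k < n) (U_ k `*` B_ k)).
  rewrite EE; apply/seteqP; split => -[x w] /=.
    move=> [[[_ Bw] h] nB]; have nBw : ~ B_ n w by move=> ?; exact: nB.
    split => //; case: h => [[Ux _]|[k /= kn [Ukx Bkw]]]; first by left.
    move: kn; rewrite ltnS leq_eqVlt => /orP[/eqP kn|kn]; last by right; exists k.
    by exfalso; apply: nBw; rewrite -kn.
  move=> [[_ [Bw nBw]] h]; split; last by move=> [].
  split => //; case: h => [Ux|[k /= kn ?]]; first by left.
  by right; exists k => //=; exact: ltnW.
apply: leeD; [apply: (IHn _ _ _ _ _ E1)|apply: (IHn _ _ _ _ _ E2)] => //.
- exact: openU.
- exact: AA_I.
- by apply: AA_I => //; exact: AA_C.
Qed.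

Let outer_rectangles (U_ : nat -> set W) (B_ : nat -> set Om) n :
  (forall k, open (U_ k)) -> (forall k, AA (B_ k)) ->
  (outer (\bigcup_(k < n) (U_ k `*` B_ k)) <=
   (nu (\bigcup_(k < n) (U_ k `*` B_ k)))%:E)%E.
Proof.
move=> oU_ AB_; apply: (outer_rectangles_split (n := n) oU_ AB_ (@open0 W) AA_T).
by rewrite setXTT setTI set0X set0U.
Qed.

(** The outer measure restricted to the product sigma-algebra. Its bounds by [nu] are one-sided, but
    the second marginal is exact because sets of [AA] and their complements are both bounded by [V].
    The last clause holds because covers by rectangles pull back along [phi] to covers that weigh no
    more. *)
Lemma content_extension : exists mu : probability (borel W * Om)%type R,
  [/\ forall U B, open U -> AA B -> (mu (U `*` B) <= (nu (U `*` B))%:E)%E,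
      forall (U_ : nat -> set W) (B_ : nat -> set Om),
        (forall k, open (U_ k)) -> (forall k, AA (B_ k)) ->
        (mu (\bigcup_k (U_ k `*` B_ k)) <= (nu (\bigcup_k (U_ k `*` B_ k)))%:E)%E,
      forall B, measurable B -> mu (setT `*` B) = V B &
      forall phi : W * Om -> W * Om,
        (forall U B, open U -> AA B -> exists U' B', [/\ open U', AA B',
           phi @^-1` (U `*` B) = U' `*` B' & nu (U' `*` B') <= nu (U `*` B)]) ->
        forall A, (mu (phi @^-1` A) <= mu A)%E].
Proof.
pose mu := image_law measurable_coordinates outer_setT.
have mu_rect U B : open U -> AA B -> (mu (U `*` B) <= (nu (U `*` B))%:E)%E.
  exact: mext_rect.
exists mu; split => // [U_ B_ oU_ AB_||phi hphi A].
- pose D n := \bigcup_(k < n) (U_ k `*` B_ k).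
  have DE : \bigcup_k (U_ k `*` B_ k) = \bigcup_n D n.
    apply/seteqP; split => z [k _]; first by exists k.+1 => //; exists k => /=.
    by case=> j _ ?; exists j.
  have mD n : measurable (D n : set (borel W * Om)).
    apply: bigcup_measurable => k _; apply: measurableX; last exact: AA_measurable.
    exact: sub_sigma_algebra.
  have ndD : nondecreasing_seq D.
    move=> m n mn; apply/subsetPset => z [k /= km ?]; exists k => //=.
    exact: leq_trans mn.
  have mUD : measurable (\bigcup_n D n : set (borel W * Om)).
    exact: bigcupT_measurable.
  have cvgD := nondecreasing_cvg_mu mD mUD ndD (mu := mu).
  rewrite DE; have <- := cvg_lim (@ereal_hausdorff R) cvgD.
  apply: lime_le; first by apply/cvg_ex; exists (mu (\bigcup_n D n)).
  apply: nearW => n; apply: le_trans (outer_rectangles n oU_ AB_) _.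
  by rewrite lee_fin; apply: nu_le => z ?; exists n.
- pose m2 := image_law (@measurable_snd _ _ (borel W) Om) (probability_setT mu).
  have m2E B : m2 B = mu (setT `*` B).
    by rewrite /m2 /image_law /pushforward; congr (mu _); apply/seteqP; split => -[x w] //= [].
  have m2_le B : AA B -> (m2 B <= V B)%E.
    by move=> AB; rewrite m2E -nuV//; exact: mu_rect openT AB.
  move=> B mB; transitivity (m2 B); first exact/esym/m2E.
  apply: (measure_unique AA (fun=> setT)) => //.
  + by rewrite bigcup_const.
  + move=> C AC; apply/eqP; rewrite eq_le m2_le//=.
    have mC := AA_measurable AC.
    suff : (V C <= m2 C)%E by [].
    (* The upper bound on the complement of [C] is the missing lower bound on [C]. *)
    have := m2_le _ (AA_C AC).
    have -> : m2 (~` C) = (1 - m2 C)%E by exact: probability_setC.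
    rewrite probability_setC//.
    have : m2 C \is a fin_num by exact: fin_num_measure.
    have : V C \is a fin_num by exact: fin_num_measure.
    by case: (V C) (m2 C) => [v| |] [x| |]//= _ _; rewrite -!EFinB !lee_fin lerD2l lerN2.
  + move=> _; suff : (m2 setT < +oo)%E by [].
    have -> : m2 setT = 1%E by exact: probability_setT.
    exact: ltry.
apply: le_ereal_inf_tmp => _ [F [_ AF] <-].
apply: (@le_trans _ _ (\sum_(k <oo) outer (phi @^-1` F k))%E).
  apply: le_trans (outer_measure_sigma_subadditive outer _).
  by apply: (le_outer_measure outer) => z /AF[k _ Fkz]; exists k.
apply: lee_nneseries => [k _ _|k _]; first exact: outer_measure_ge0.
rewrite /weight; case: asboolP => [[U [B [oU AB ->]]]|_]; last by rewrite leey.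
have [U' [B' [oU' AB' -> le_nu]]] := hphi _ _ oU AB.
by apply: le_trans (mext_rect oU' AB') _; rewrite lee_fin.
Qed.

End content_extension.

(** * The maximal inequality and ergodic frequencies *)

Lemma ae_probability1 d (T : measurableType d) (R : realType)
    (Q : probability T R) (A : set T) : measurable A ->
  {ae Q, forall v, A v} <-> Q A = 1%E.
Proof.
move=> mA; have mAC := measurableC mA.
have -> : {ae Q, forall v, A v} <-> Q.-negligible (~` A) by [].
rewrite negligibleP//=; have := fin_num_measure Q _ mA.
have -> : Q (~` A) = (1 - Q A)%E by exact: probability_setC.
case: (Q A) => // r _; rewrite -EFinB; split => -[]; last by move=> ->; rewrite subrr.
by move/eqP; rewrite subr_eq0 => /eqP <-.
Qed.

Section measure_preserving.
Context d (T : measurableType d) (R : realType) (Q : probability T R).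
Variable s : T -> T.
Hypothesis ms : measurable_fun setT s.
Hypothesis Qs : forall A, measurable A -> Q (s @^-1` A) = Q A.

Lemma measurable_fun_iter k : measurable_fun setT (iter k s).
Proof.
elim: k => [|k IHk]; first exact: measurable_id.
exact: measurableT_comp ms IHk.
Qed.

Let measurable_pre k A : measurable A -> measurable (iter k s @^-1` A).
Proof.
by move=> mA; rewrite -[_ @^-1` _]setTI; exact: (measurable_fun_iter k).
Qed.

Lemma preserved_iter k A : measurable A -> Q (iter k s @^-1` A) = Q A.
Proof.
elim: k A => [//|k IHk] A mA; rewrite -[RHS](Qs mA) -[RHS]IHk//.
by have := @measurable_pre 1 A mA.
Qed.

Lemma integral_preserved_iter k (phi : T -> \bar R) : measurable_fun setT phi ->
  (forall v, 0 <= phi v)%E -> (\int[Q]_v phi (iter k s v) = \int[Q]_v phi v)%E.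
Proof.
move=> mphi phi0.
pose sk : {mfun T >-> T} := HB.pack (iter k s)
  (isMeasurableFun.Build _ _ _ _ (iter k s) (measurable_fun_iter k)).
rewrite -(@ge0_integral_pushforward _ _ _ _ _ sk _ Q setT)//.
by apply: eq_measure_integral => A mA _; exact: preserved_iter.
Qed.

Let sums (phi : T -> R) n v := \sum_(k < n) phi (iter k s v).

Let sumsD (phi : T -> R) m n v :
  sums phi (m + n) v = sums phi m v + sums phi n (iter m s v).
Proof.
rewrite /sums big_split_ord/=; congr (_ + _).
by apply: eq_bigr => k _; rewrite addnC iterD.
Qed.

Let sums_ge0 (phi : T -> R) n v : (forall v, 0 <= phi v) -> 0 <= sums phi n v.
Proof. by move=> phi0; exact: sumr_ge0. Qed.

Let sums_le (phi : T -> R) m n v : (forall v, 0 <= phi v) -> (m <= n)%N ->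
  sums phi m v <= sums phi n v.
Proof. by move=> phi0 /subnKC <-; rewrite sumsD lerDl sums_ge0. Qed.

Let measurable_sums (phi : T -> R) n : measurable_fun setT phi ->
  measurable_fun setT (sums phi n).
Proof.
move=> mphi; apply: measurable_sum => k.
by apply: measurableT_comp mphi (measurable_fun_iter k).
Qed.

Let integral_sums (phi : T -> R) n : measurable_fun setT phi ->
  (forall v, 0 <= phi v) ->
  (\int[Q]_v (sums phi n v)%:E = n%:R%:E * \int[Q]_v (phi v)%:E)%E.
Proof.
move=> mphi phi0.
have mphiE : measurable_fun setT (EFin \o phi) by exact/measurable_EFinP.
under eq_integral do rewrite -sumEFin.
rewrite ge0_integral_sum//; last 2 first.
- by move=> k; exact: measurableT_comp mphiE (measurable_fun_iter k).
- by move=> k v _; rewrite lee_fin.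
rewrite (eq_bigr (fun=> \int[Q]_v (phi v)%:E)%E).
  have : (0 <= \int[Q]_v (phi v)%:E)%E.
    by apply: integral_ge0 => v _; rewrite lee_fin.
  move: (integral _ _ _) => x x0; elim: n => [|n IHn].
    by rewrite big_ord0 mul0e.
  by rewrite big_ord_recr/= IHn -natr1 EFinD ge0_muleDl ?mul1e// lee_fin.
by move=> k _; apply: (integral_preserved_iter k mphiE) => v; rewrite lee_fin.
Qed.

(** The bound [L] on the waiting time is what keeps a tiling of [[0, N)] from overshooting by more
    than [L]. *)
Let early (phi : T -> R) (c : R) L := [set v | exists n,
  [/\ (0 < n)%N, (n <= L)%N & c * n%:R <= sums phi n v]].

(* Greedily tile [0, N) with blocks of length at most [L] starting at visits to
   [early], each carrying average at least [c], and skipping the other times. *)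
Let tiling (phi : T -> R) (c : R) L N v : (forall v, 0 <= phi v) -> 0 <= c ->
  c * sums \1_(early phi c L) N v <= sums phi (N + L) v.
Proof.
move=> phi0 c0; set E := early phi c L; have E0 v' : 0 <= \1_E v' :> R by rewrite indicE.
have Esums m v' : sums (\1_E : T -> R) m v' <= m%:R.
  rewrite /sums -[m in leRHS]card_ord -sumr_const; apply: ler_sum => k _.
  by rewrite indicE; case: (_ \in _).
have [m] := ubnP N; elim: m N v => [//|m IHm] N v; rewrite ltnS => Nm.
have [Ev|nEv] := pselect (E v).
  have [n [n0 nL hn]] := Ev; have [nN|Nn] := leqP n N.
    rewrite -(subnKC nN) -addnA [in leLHS]sumsD [in leRHS]sumsD mulrDr lerD//.
      by apply: le_trans hn; rewrite ler_wpM2l.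
    by apply: IHm; rewrite (leq_trans _ Nm)// ltn_subrL n0 (leq_trans n0 nN).
  apply: (@le_trans _ _ (c * N%:R)); first by rewrite ler_wpM2l.
  apply: (@le_trans _ _ (c * n%:R)); first by rewrite ler_wpM2l// ler_nat ltnW.
  apply: le_trans hn _; apply: sums_le => //.
  exact: leq_trans nL (leq_addl _ _).
case: N Nm => [_|N Nm]; first by rewrite /sums big_ord0 mulr0 sumr_ge0.
rewrite -(add1n N) -addnA [in leLHS]sumsD [in leRHS]sumsD mulrDr lerD//.
  by rewrite {1}/sums big_ord1/= indicE memNset// mulr0 sums_ge0.
exact: IHm.
Qed.

(** Integrating the tiling estimate gives [c * N * Q (E L) <= (N + L) * I]. Letting [N] grow removes
    the overshoot, and then [E L] increases to a set of full measure. *)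
Lemma maximal_inequality (phi : T -> R) (c : R) :
  measurable_fun setT phi -> (forall v, 0 <= phi v) ->
  {ae Q, forall v, exists2 n, (0 < n)%N &
    c * n%:R <= \sum_(k < n) phi (iter k s v)} ->
  (c%:E <= \int[Q]_v (phi v)%:E)%E.
Proof.
move=> mphi phi0 hphi.
have [c0|c0] := ltP c 0.
  apply: (@le_trans _ _ 0%E); first by rewrite lee_fin ltW.
  by apply: integral_ge0 => v _; rewrite lee_fin.
have mphiE : measurable_fun setT (EFin \o phi) by exact/measurable_EFinP.
have [->|phi_fin] := eqVneq (\int[Q]_v (phi v)%:E)%E +oo%E; first by rewrite leey.
have {phi_fin} : (\int[Q]_v (phi v)%:E)%E \is a fin_num.
  by rewrite ge0_fin_numE ?ltey//; apply: integral_ge0 => v _; rewrite lee_fin.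
move=> /fineK; set I := fine _ => IE; rewrite -IE.
pose E := early phi c.
have mE L : measurable (E L).
  rewrite (_ : E L = \bigcup_(n in [set n | (0 < n <= L)%N])
      [set v | c * n%:R <= sums phi n v]).
    apply: bigcup_measurable => n _.
    rewrite -[mkset _]setTI.
    by apply: measurable_fun_le => //; exact: measurable_sums.
  apply/seteqP; split => v [n]; first by case=> n0 nL hn; exists n => //=; rewrite n0.
  by case/andP => n0 nL hn; exists n.
have QE L : Q (E L) = (fine (Q (E L)))%:E by rewrite fineK// fin_num_measure.
have key L N : c * N%:R * fine (Q (E L)) <= (N + L)%:R * I.
  rewrite -lee_fin [in leRHS]EFinM IE -integral_sums//.
  apply: (@le_trans _ _ (\int[Q]_v (c * sums \1_(E L) N v)%:E)%E); last first.
    apply: ge0_le_integral => //.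
    - by move=> v _; rewrite lee_fin mulr_ge0// sums_ge0.
    - apply/measurable_EFinP; apply: measurable_funM => //.
      by apply: measurable_sums; exact: measurable_indic.
    - by apply/measurable_EFinP; exact: measurable_sums.
    - by move=> v _; rewrite lee_fin tiling.
  under eq_integral do rewrite EFinM.
  rewrite ge0_integralZl_EFin//.
  - rewrite integral_sums//.
    have -> : (\int[Q]_v (\1_(E L) v)%:E = (fine (Q (E L)))%:E)%E.
      by rewrite integral_indic// setIT -QE.
    by rewrite -!EFinM mulrA.
  - by move=> v _; rewrite lee_fin sums_ge0.
  - by apply/measurable_EFinP; apply: measurable_sums; exact: measurable_indic.
have keyL L : c * fine (Q (E L)) <= I.
  rewrite leNgt; apply/negP; rewrite -subr_gt0; set e := _ - _ => e0.
  have I0 : 0 <= I.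
    by rewrite -lee_fin IE; apply: integral_ge0 => v _; rewrite lee_fin.
  (* With [e] the supposed excess, any [N] beyond [L * I / e] contradicts [key]. *)
  have LIe : 0 <= L%:R * I / e by rewrite divr_ge0 ?mulr_ge0// ltW.
  have := archi_boundP LIe; set N := Num.bound _; rewrite ltr_pdivrMr// => LIN.
  have := key L N; rewrite natrD; move: LIN; rewrite /e; nra.
have nd : nondecreasing_seq E.
  move=> m n mn; apply/subsetPset => v [k [k0 km hk]]; exists k; split => //.
  exact: leq_trans mn.
have mUE : measurable (\bigcup_L E L) by exact: bigcupT_measurable.
have QU : Q (\bigcup_L E L) = 1%E.
  apply/ae_probability1 => //; apply: filterS hphi => v [n n0 hn].
  by exists n => //; exists n.
have cvgE : (fun L => Q (E L)) @ \oo --> 1%E.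
  by rewrite -QU; exact: nondecreasing_cvg_mu.
have cvgcE : (fun L => c%:E * Q (E L))%E @ \oo --> c%:E.
  by rewrite -[X in _ --> X]mule1; exact: cvgeZl.
have <- := cvg_lim (@ereal_hausdorff R) cvgcE.
apply: lime_le; first by apply/cvg_ex; exists c%:E.
by apply: nearW => L /=; rewrite QE -EFinM lee_fin.
Qed.

(** The constant [C] disappears because all [M] are intersected, so the preimage of [B] lies in [B].
    The iterated preimages then decrease, all have the measure of [B], and their intersection is
    strictly invariant. *)
Lemma zero_one (A : nat -> nat -> set T) (C : nat) :
  (forall B, measurable B -> s @^-1` B = B -> Q B = 0%E \/ Q B = 1%E) ->
  (forall n M, measurable (A n M)) ->
  (forall n M, s @^-1` A n (M + C)%N `<=` A n.+1 M) ->
  let B := \bigcap_M \bigcup_n A n M in Q B = 0%E \/ Q B = 1%E.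
Proof.
move=> Qerg mA sA B.
have mB : measurable B.
  by apply: bigcapT_measurable => M; exact: bigcupT_measurable.
have sB : s @^-1` B `<=` B.
  move=> v Bsv M _; have [n _ Anv] := Bsv (M + C)%N I.
  by exists n.+1 => //; exact: sA.
pose D k := iter k s @^-1` B.
have mD k : measurable (D k) by exact: measurable_pre.
have ndD : nonincreasing_seq D.
  apply/nonincreasing_seqP => k; apply/subsetPset => v Dv.
  exact: sB.
have mID : measurable (\bigcap_k D k) by exact: bigcapT_measurable.
have cvgD := nonincreasing_cvg_mu _ mD mID ndD (mu := Q).
have <- : Q (\bigcap_k D k) = Q B.
  have := cvgD; rewrite (_ : Q \o D = cst (Q B)); last first.
    by apply/funext => k /=; exact: preserved_iter.
  have Q0 : (Q (D 0%N) < +oo)%E by rewrite ltey_eq fin_num_measure.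
  by move=> /(_ Q0)/cvg_lim => <-//; rewrite lim_cst.
apply: Qerg => //; apply/seteqP; split => v h k _.
  case: k => [|k]; first by apply: sB; exact: (h 0%N I).
  by have := h k I; rewrite /D /preimage/= -iterSr.
by have := h k.+1 I; rewrite /D /preimage/= -iterS iterSr.
Qed.

(** In its uses [A n M] says that a total over [n.+1] steps exceeds [c * n.+1%:R] by more than [M].
    A nonnegative first term can only increase the total, and [C] is an integer above the change of
    threshold caused by one more step. *)
Lemma ae_eventually_not (A : nat -> nat -> set T) (C : nat) :
  (forall B, measurable B -> s @^-1` B = B -> Q B = 0%E \/ Q B = 1%E) ->
  (forall n M, measurable (A n M)) ->
  (forall n M, s @^-1` A n (M + C)%N `<=` A n.+1 M) ->
  ~ {ae Q, forall v, forall M, exists n, A n M v} ->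
  {ae Q, forall v, exists M, forall n, ~ A n M v}.
Proof.
move=> Qerg mA sA nA.
have mB : measurable (\bigcap_M \bigcup_n A n M).
  by apply: bigcapT_measurable => M; exact: bigcupT_measurable.
have [B0|/(ae_probability1 Q mB) B1] := zero_one Qerg mA sA.
  exists (\bigcap_M \bigcup_n A n M); split => // v h M _.
  apply: contrapT => nAv; apply: h; exists M => n Anv.
  by apply: nAv; exists n.
exfalso; apply: nA; apply: filterS B1 => v h M.
by have [n _ ?] := h M I; exists n.
Qed.

(** If the excess of visits were unbounded almost everywhere, the maximal inequality for the
    indicator of [B] would give [c <= Q B]. *)
Let ae_visits_le (B : set T) (c : R) :
  (forall B, measurable B -> s @^-1` B = B -> Q B = 0%E \/ Q B = 1%E) ->
  measurable B -> (Q B < c%:E)%E ->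
  {ae Q, forall v, exists M, forall n, sums \1_B n.+1 v <= c * n.+1%:R + M%:R}.
Proof.
move=> Qerg mB QBc.
have c0 : 0 <= c by rewrite -lee_fin; apply: le_trans (ltW QBc); exact: measure_ge0.
pose A n (M : nat) := [set v | c * n.+1%:R + M%:R < sums \1_B n.+1 v].
have : {ae Q, forall v, exists M, forall n, ~ A n M v}.
  apply: (@ae_eventually_not A (Num.bound c)) => // [n M|n M v /=|].
  - rewrite (_ : A _ _ = ~` [set v | sums \1_B n.+1 v <= c * n.+1%:R + M%:R]).
      apply: measurableC; rewrite -[mkset _]setTI.
      apply: measurable_fun_le => //.
      by apply: measurable_sums; exact: measurable_indic.
    by apply/seteqP; split => v; rewrite /A /= ltNge => /negP.
  - rewrite /A /=; have := archi_boundP c0.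
    have -> := sumsD \1_B 1 n.+1 v; rewrite /= -[n.+2]addn1 natrD.
    have : 0 <= sums (\1_B : T -> R) 1 v by apply: sums_ge0 => ?; rewrite indicE.
    rewrite natrD /=; nra.
  - move=> h; have : (c%:E <= \int[Q]_v (\1_B v)%:E)%E.
      apply: maximal_inequality => [|v|].
      + exact: measurable_indic.
      + by rewrite indicE.
      + apply: filterS h => v /(_ 0%N)[n]; rewrite /A /= addr0 => /ltW ?.
        by exists n.+1.
    by rewrite integral_indic// setIT leNgt QBc.
apply: filterS => v [M hM]; exists M => n.
by rewrite leNgt; apply/negP; exact: hM.
Qed.

(** Birkhoff's theorem for an indicator: the upper bound on visits to the complement is the lower
    bound on visits to [B]. *)
Lemma ergodic_frequency (B : set T) :
  (forall B, measurable B -> s @^-1` B = B -> Q B = 0%E \/ Q B = 1%E) ->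
  measurable B ->
  {ae Q, forall v, (fun n => n%:R^-1 * \sum_(k < n) \1_B (iter k s v)) @ \oo
    --> fine (Q B)}.
Proof.
move=> Qerg mB; pose e j : R := j.+1%:R^-1.
have e0 j : 0 < e j by rewrite invr_gt0.
have QE C : measurable C -> Q C = (fine (Q C))%:E.
  by move=> mC; rewrite fineK// fin_num_measure.
have up C j : measurable C -> {ae Q, forall v, exists M : nat, forall n,
    sums \1_C n.+1 v <= (fine (Q C) + e j) * n.+1%:R + M%:R}.
  by move=> mC; apply: ae_visits_le => //; rewrite (QE _ mC) lte_fin ltrDl.
have hB : {ae Q, forall v, forall j, exists M : nat, forall n,
    sums \1_B n.+1 v <= (fine (Q B) + e j) * n.+1%:R + M%:R}.
  by apply: ae_foralln => j; exact: up.
have hBC : {ae Q, forall v, forall j, exists M : nat, forall n,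
    sums \1_(~` B) n.+1 v <= (fine (Q (~` B)) + e j) * n.+1%:R + M%:R}.
  by apply: ae_foralln => j; apply: up; exact: measurableC.
have QBC : fine (Q (~` B)) = 1 - fine (Q B).
  by rewrite probability_setC// [in LHS](QE _ mB).
have sumsC n v : sums \1_(~` B) n v = n%:R - sums \1_B n v.
  rewrite -[n%:R]mulr1 -[n in n%:R * _]card_ord mulr_natl -sumr_const -sumrB.
  by apply: eq_bigr => k _; rewrite !indicE in_setC; case: (_ \in _); rewrite ?subrr ?subr0.
apply: filterS2 hB hBC => v h1 h2.
apply/cvgrPdist_le => eps eps0.
have [j _ /(_ j (leqnn j)) ej] := near_infty_natSinv_lt (PosNum (divr_gt0 eps0 (ltr0n R 2))).
have [M1 {}h1] := h1 j; have [M2 {}h2] := h2 j.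
near=> n.
have n0 : (0 < n)%N by near: n; exact: nbhs_infty_gt.
have nr0 : 0 < n%:R :> R by rewrite ltr0n.
have M1n : M1%:R <= eps / 2 * n%:R.
  rewrite mulrC -ler_pdivrMr ?divr_gt0//.
  by near: n; exact: nbhs_infty_ger.
have M2n : M2%:R <= eps / 2 * n%:R.
  rewrite mulrC -ler_pdivrMr ?divr_gt0//.
  by near: n; exact: nbhs_infty_ger.
have := h1 n.-1; have := h2 n.-1; rewrite prednK// sumsC QBC.
rewrite -/(sums _ _ _); set S := sums _ _ _ => H2 H1.
have SE : S = n%:R^-1 * S * n%:R by rewrite mulrAC mulVf ?mul1r// gt_eqF.
move: ej H1 H2; rewrite /= -/(e j); set a := n%:R^-1 * S in SE *; rewrite SE.
move=> ej H1 H2; have ejn : e j * n%:R <= eps / 2 * n%:R by rewrite ler_pM2r// ltW.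
rewrite ler_distl; apply/andP; split; rewrite -(ler_pM2r nr0); lra.
Unshelve. all: by end_near. Qed.

End measure_preserving.

(** * A countable algebra of cylinders generating the sequence space *)

(* Codes for the sets of a countable algebra: countability is what lets almost
   every path be generic for all of them at once. *)
Inductive cylinder_formula :=
  | CylBall of nat * rat * nat
  | CylNot of cylinder_formula
  | CylAnd of cylinder_formula & cylinder_formula.

Fixpoint encode_formula (p : cylinder_formula) : GenTree.tree (nat * rat * nat) :=
  match p with
  | CylBall a => GenTree.Leaf a
  | CylNot p => GenTree.Node 0 [:: encode_formula p]
  | CylAnd p q => GenTree.Node 1 [:: encode_formula p; encode_formula q]
  end.

Fixpoint decode_formula (t : GenTree.tree (nat * rat * nat)) : option cylinder_formula :=
  match t with
  | GenTree.Leaf a => Some (CylBall a)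
  | GenTree.Node 0 [:: t] => omap CylNot (decode_formula t)
  | GenTree.Node 1 [:: t; u] =>
      obind (fun p => omap (CylAnd p) (decode_formula u)) (decode_formula t)
  | _ => None
  end.

Lemma encode_formulaK : pcancel encode_formula decode_formula.
Proof. by elim=> [a//|p /= ->//|p /= -> q /= ->]. Qed.

HB.instance Definition _ := Countable.copy cylinder_formula (pcan_type encode_formulaK).

Lemma measurable_shift d (S : measurableType d) : measurable_fun setT (@shift _ S).
Proof.
apply: (@measurability _ _ (seqspace S) (seqspace S) _ _ (@cylinders _ S)) => //.
move=> _ [_ [k [B [mB ->]]] <-]; rewrite setTI.
by apply: sub_sigma_algebra; exists k.+1, B.
Qed.

Section sequence_space.
Variable R : realType.

Definition ball_cylinder (a : nat * rat * nat) : set (seqspace R) :=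
  [set y | `|y a.1.1 - ratr a.1.2| < a.2.+1%:R^-1].

Fixpoint cylinder_set (p : cylinder_formula) : set (seqspace R) :=
  match p with
  | CylBall a => ball_cylinder a
  | CylNot p => ~` cylinder_set p
  | CylAnd p q => cylinder_set p `&` cylinder_set q
  end.

(** Openness for the product topology, spelled out in coordinates. *)
Definition finitely_open (A : set (nat -> R)) := forall y, A y ->
  exists n e, 0 < e /\
    forall y', (forall k, (k < n)%N -> `|y' k - y k| < e) -> A y'.

Lemma finitely_open_sigma (A : set (nat -> R)) :
  finitely_open A -> <<s range ball_cylinder >> A.
Proof.
move=> oA.
pose box (i : nat * seq rat) : set (nat -> R) :=
  \bigcap_(k in `I_(size i.2)) ball_cylinder (k, nth 0 i.2 k, i.1).
pose F i := if `[< box i `<=` A >] then box i else set0.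
have -> : A = \bigcup_i F i.
  apply/seteqP; split => y; last first.
    by case=> i _; rewrite /F; case: asboolP => // h /h.
  move=> /oA[n [e [e0 hA]]].
  have [j _ /(_ j (leqnn j)) ej] := near_infty_natSinv_lt (PosNum (divr_gt0 e0 (ltr0n R 2))).
  have j0 : 0 < j.+1%:R^-1 :> R by rewrite invr_gt0.
  have /choice[q hq] : forall k, exists q : rat, `|y k - ratr q| < j.+1%:R^-1.
    move=> k; have [|q] := @rat_in_itvoo R (y k - j.+1%:R^-1) (y k + j.+1%:R^-1).
      by rewrite ltrD2l gtrN.
    by rewrite in_itv/= -ltr_distl distrC => ?; exists q.
  exists (j, mkseq q n) => //; rewrite /F; case: asboolP => [_|[]].
    by move=> k /=; rewrite size_mkseq => kn; rewrite /ball_cylinder/= nth_mkseq.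
  move=> y' hy'; apply: hA => k kn.
  have := hy' k; rewrite /= size_mkseq => /(_ kn).
  rewrite /ball_cylinder/= nth_mkseq// => hk.
  rewrite -(subrKA (ratr (q k))); apply: le_lt_trans (ler_normD _ _) _.
  by rewrite [e]splitr ltrD// ?(lt_trans hk)// distrC (lt_trans (hq k)).
apply: (@countable_bigcupT_measurable _ (g_sigma_algebraType (range ball_cylinder))).
  exact: countableP.
move=> i; rewrite /F; case: asboolP => _; last exact: measurable0.
apply: fin_bigcap_measurable => [|k _]; first exact: finite_II.
by apply: sub_sigma_algebra; exists (k, nth 0 i.2 k, i.1).
Qed.

Lemma measurable_seqspaceE :
  @measurable _ (seqspace R) = <<s range ball_cylinder >>.
Proof.
apply/seteqP; split; apply: smallest_sub; try exact: smallest_sigma_algebra.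
  move=> _ [k [B [mB ->]]].
  pose G := g_sigma_algebraType (range ball_cylinder).
  suff : measurable_fun setT ((fun u => u k) : G -> R).
    by move=> /(_ measurableT B mB); rewrite setTI.
  apply: (measurability _ (RGenOpens.measurableE R)) => _ [_ [x [z ->]] <-].
  rewrite setTI; apply: finitely_open_sigma => y /=; rewrite in_itv/= => /andP[xy yz].
  exists k.+1, (Num.min (y k - x) (z - y k)); split.
    by rewrite lt_min !subr_gt0 xy yz.
  move=> y' /(_ k (ltnSn k)); rewrite lt_min !ltr_distl in_itv/=.
  by move=> /andP[/andP[h1 _] /andP[_ h2]]; lra.
move=> _ [a _ <-]; apply: sub_sigma_algebra.
exists a.1.1, [set r | `|r - ratr a.1.2| < a.2.+1%:R^-1]; split => //.
have -> : [set r : R | `|r - ratr a.1.2| < a.2.+1%:R^-1] = ball (ratr a.1.2 : R) (a.2.+1%:R^-1).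
  by apply/seteqP; split => r; rewrite /ball/= distrC.
exact: measurable_ball.
Qed.

Lemma measurable_finitely_open (A : set (seqspace R)) :
  finitely_open A -> measurable A.
Proof. by rewrite measurable_seqspaceE; exact: finitely_open_sigma. Qed.

Definition cylinder_algebra : set_system (seqspace R) := range cylinder_set.

Lemma cylinder_algebraT : cylinder_algebra setT.
Proof.
pose p := CylBall (0%N, 0, 0%N); exists (CylNot (CylAnd p (CylNot p))) => //=.
by rewrite setICr setC0.
Qed.

Lemma cylinder_algebraI : setI_closed cylinder_algebra.
Proof. by move=> _ _ [p _ <-] [q _ <-]; exists (CylAnd p q). Qed.

Lemma cylinder_algebraC : setC_closed cylinder_algebra.
Proof. by move=> _ [p _ <-]; exists (CylNot p). Qed.

Lemma measurable_ball_cylinder a : measurable (ball_cylinder a).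
Proof.
by rewrite measurable_seqspaceE; apply: sub_sigma_algebra; exists a.
Qed.

Lemma measurable_cylinder_algebra : cylinder_algebra `<=` measurable.
Proof.
move=> _ [p _ <-]; elim: p => [a|p IHp|p IHp q IHq] /=.
- exact: measurable_ball_cylinder.
- exact: measurableC.
- exact: measurableI.
Qed.

Lemma cylinder_algebra_generates :
  @measurable _ (seqspace R) `<=` <<s cylinder_algebra >>.
Proof.
rewrite measurable_seqspaceE; apply: smallest_sub; first exact: smallest_sigma_algebra.
by move=> _ [a _ <-]; apply: sub_sigma_algebra; exists (CylBall a).
Qed.

Fixpoint shift_formula (p : cylinder_formula) : cylinder_formula :=
  match p with
  | CylBall a => CylBall (a.1.1.+1, a.1.2, a.2)
  | CylNot p => CylNot (shift_formula p)
  | CylAnd p q => CylAnd (shift_formula p) (shift_formula q)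
  end.

Lemma cylinder_algebra_shift A :
  cylinder_algebra A -> cylinder_algebra (@shift _ R @^-1` A).
Proof.
move=> [p _ <-]; exists (shift_formula p) => //.
by elim: p => [a|p /= ->|p /= -> q ->].
Qed.

End sequence_space.

(** * Lower semicontinuous losses on the plane *)

(** The two sides play different roles later: the first is pulled back to an open set of states by a
    continuous observation, while the second must be a rational ball in order to define a
    [ball_cylinder]. *)
Lemma open_plane_boxes (R : realType) (O : set (R * R)) : open O ->
  exists (P : nat -> set R) (q : nat -> rat) (j : nat -> nat),
    (forall k, open (P k)) /\
    O = \bigcup_k (P k `*` [set r | `|r - ratr (q k)| < (j k).+1%:R^-1]).
Proof.
move=> oO.
pose box (i : rat * rat * nat) : set (R * R) :=
  [set r | `|r - ratr i.1.1| < i.2.+1%:R^-1] `*`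
  [set r | `|r - ratr i.1.2| < i.2.+1%:R^-1].
pose P k := if unpickle k is Some i then
  if `[< box i `<=` O >] then [set r : R | `|r - ratr i.1.1| < i.2.+1%:R^-1]
  else set0 else set0.
pose q k : rat := if unpickle k is Some i then (i : rat * rat * nat).1.2 else 0.
pose j k : nat := if unpickle k is Some i then (i : rat * rat * nat).2 else 0%N.
exists P, q, j; split.
  move=> k; rewrite /P; case: unpickle => [i|]; last exact: open0.
  case: asboolP => _; last exact: open0.
  have -> : [set r : R | `|r - ratr i.1.1| < i.2.+1%:R^-1] =
      ball (ratr i.1.1 : R) (i.2.+1%:R^-1).
    by apply/seteqP; split => r; rewrite /ball/= distrC.
  exact: ball_open.
apply/seteqP; split => -[u v]; last first.
  move=> [k _]; rewrite /P /q /j; case: unpickle => [i|]; last by case.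
  case: asboolP => [iO|_ []//] uv; exact: iO.
move=> Ouv; have [e /= e0 eO] : nbhs_ball (u, v) O.
  by apply/nbhs_ballP; exact: open_nbhs_nbhs.
have [m _ /(_ m (leqnn m)) em] :=
  near_infty_natSinv_lt (PosNum (divr_gt0 e0 (ltr0n R 2))).
have approx (z : R) : exists p : rat, `|z - ratr p| < m.+1%:R^-1.
  have [|p] := @rat_in_itvoo R (z - m.+1%:R^-1) (z + m.+1%:R^-1).
    by rewrite ltrD2l gtrN// invr_gt0.
  by rewrite in_itv/= -ltr_distl distrC => ?; exists p.
have [[p hp] [p' hp']] := (approx u, approx v).
have [k kE] : exists k, unpickle k = Some (p, p', m).
  by exists (pickle (p, p', m)); exact: pickleK.
exists k => //; rewrite /P /q /j kE.
case: asboolP => [//|[]] -[u' v'] [/= hu' hv']; apply: eO; split => /=.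
  rewrite /ball/= -(subrKA (ratr p)) [e]splitr; apply: le_lt_trans (ler_normD _ _) _.
  by rewrite ltrD// ?(lt_trans hp)// distrC (lt_trans hu').
rewrite /ball/= -(subrKA (ratr p')) [e]splitr; apply: le_lt_trans (ler_normD _ _) _.
by rewrite ltrD// ?(lt_trans hp')// distrC (lt_trans hv').
Qed.

Lemma lower_semicontinuous_plane_measurable (R : realType) (l : R * R -> R) :
  lower_semicontinuous (fun z => (l z)%:E) -> measurable_fun setT l.
Proof.
move=> /lower_semicontinuousP lsc.
apply: (measurability _ (RGenOInfty.measurableE R)) => _ [_ [c ->] <-].
rewrite setTI.
have [P [q [j [oP E]]]] := open_plane_boxes (lsc c).
have -> : l @^-1` `]c, +oo[%classic =
    \bigcup_k (P k `*` [set r | `|r - ratr (q k)| < (j k).+1%:R^-1]).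
  by rewrite -E; apply/seteqP; split => z /=; rewrite in_itv/= andbT lte_fin.
apply: bigcupT_measurable => k; apply: measurableX; first exact: open_measurable.
have -> : [set r : R | `|r - ratr (q k)| < (j k).+1%:R^-1] =
      ball (ratr (q k) : R) ((j k).+1%:R^-1).
  by apply/seteqP; split => r; rewrite /ball/= distrC.
exact: measurable_ball.
Qed.

(** * Borel maps, open sets as superlevel sets, bounded limits along ultrafilters *)

Lemma continuous_borel_measurable (W1 W2 : ptopologicalType) (h : W1 -> W2) :
  continuous h -> measurable_fun setT (h : borel W1 -> borel W2).
Proof.
move=> /continuousP ch.
apply: (@measurability _ _ (borel W1) (borel W2) _ _ (@open W2)) => // _ [G oG <-].
by rewrite setTI; apply: sub_sigma_algebra; exact: ch.
Qed.

Lemma continuous_borel_measurableR (R : realType) (W : ptopologicalType) (h : W -> R) :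
  continuous h -> measurable_fun setT (h : borel W -> R).
Proof.
move=> /continuousP ch; apply: (measurability _ (RGenOpens.measurableE R)).
move=> _ [_ [a [b ->] <-]]; rewrite setTI; apply: sub_sigma_algebra.
exact/ch/interval_open.
Qed.

(** The distance to the complement; it is [+oo] when [O] is the whole space, hence the extended
    values. *)
Lemma open_superlevel (R : realType) (W : pseudoMetricType R) (O : set W) :
  open O -> exists2 h : W -> \bar R, continuous h & O = [set w | (0 < h w)%E].
Proof.
move=> oO; exists (edist_inf (~` O)); first exact: edist_inf_continuous.
apply/seteqP; split => w /=; last first.
  by apply: contraPP => nOw; rewrite (edist_inf0 nOw) ltxx.
move=> Ow; have [e /= e0 eO] : nbhs_ball w O.
  by apply/nbhs_ballP; exact: open_nbhs_nbhs.
apply: (@lt_le_trans _ _ e%:E); first by rewrite lte_fin.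
apply: le_ereal_inf_tmp => _ [a nOa <-]; rewrite leNgt; apply/negP.
by move=> /edist_lt_ball /eO.
Qed.

Lemma ultra_bounded_cvg (R : realType) (I : Type) (U : set_system I)
    (h : I -> R) (M : R) :
  UltraFilter U -> (forall i, `|h i| <= M) -> exists p : R, h @ U --> p.
Proof.
move=> UU hM; have cpt := @segment_compact R (- M) M.
have [p [_ clp]] : `[- M, M]%classic `&` cluster (h @ U) !=set0.
  apply: cpt; apply: nearW => i; rewrite /= in_itv/= -ler_norml.
  exact: hM.
exists p => B nB; have [//|UC] := in_ultra_setVsetC (h @^-1` B) UU.
by have [x [nBx Bx]] := clp (~` B) B UC nB.
Qed.

(** * Limits of empirical measures are joinings *)

Lemma iter_shift d (S : measurableType d) k (u : seqspace S) j :
  iter k (@shift _ S) u j = u (k + j)%N.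
Proof. by elim: k u => [//|k IHk] u; rewrite iterSr IHk /shift addSn. Qed.

Definition generic (R : realType) (V : probability (seqspace R) R) (y : seqspace R) :=
  forall p, (fun n => n%:R^-1 *
      \sum_(k < n) \1_(@cylinder_set R p) (iter k (@shift _ R) y)) @ \oo
    --> fine (V (cylinder_set p)).

Lemma ae_generic (R : realType) (V : probability (seqspace R) R) :
  stationary V -> ergodic V -> {ae V, forall y, generic V y}.
Proof.
move=> Vst Verg.
have h (n : nat) : {ae V, forall y, if unpickle n is Some p then
    (fun n => n%:R^-1 *
      \sum_(k < n) \1_(@cylinder_set R p) (iter k (@shift _ R) y)) @ \oo
    --> fine (V (cylinder_set p)) else True}.
  case: unpickle => [p|]; last exact: aeW.
  apply: ergodic_frequency => //; first exact: measurable_shift.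
  by apply: measurable_cylinder_algebra; exists p.
have := ae_foralln h; apply: filterS => y hy p.
by have := hy (pickle p); rewrite pickleK.
Qed.

(* Products of pointed topological spaces lack this join in the library. *)
HB.instance Definition _ (A B : ptopologicalType) := Pointed.on (A * B)%type.

Section limit_joining.
Context (R : realType) (X Theta : pmetricType R).
Variables (T : Theta -> X -> X) (f : Theta -> X -> R).
Hypothesis hD : continuous_family T f.
Variables (l : R * R -> R).
Hypotheses (l_ge0 : forall z, 0 <= l z)
  (l_lsc : lower_semicontinuous (fun z : R * R => (l z)%:E)).
Variable V : probability (seqspace R) R.

(** Carrying the parameter as a conserved coordinate turns varying parameters into a single
    continuous system. *)
Definition skew (w : Theta * X) : Theta * X := (w.1, T w.1 w.2).

Lemma iter_skew k w : iter k skew w = (w.1, iter k (T w.1) w.2).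
Proof. by elim: k => [|k /= ->//]; case: w. Qed.

Let obs (w : Theta * X) : R := f w.1 w.2.

Lemma continuous_skew : continuous skew.
Proof.
case: hD => _ _ cT _ w; apply: (cvg_pair (G := nbhs w.1) (H := nbhs (T w.1 w.2))).
  exact: cvg_fst.
exact: cT.
Qed.

Lemma continuous_iter_skew k : continuous (iter k skew).
Proof.
elim: k => [|k IHk] w; first exact: cvg_id.
by apply: continuous_comp; [exact: IHk|exact: continuous_skew].
Qed.

Let continuous_obs : continuous obs.
Proof. by case: hD. Qed.

Section along_ultrafilter.
Variables (U : set_system (nat * (Theta * X))) (t : Theta) (y : seqspace R).
Hypotheses (UU : UltraFilter U) (U_oo : fst @ U --> \oo)
  (U_t : (fun i => i.2.1) @ U --> t) (y_gen : generic V y).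

Let avg (q : (Theta * X) * seqspace R -> R) (i : nat * (Theta * X)) : R :=
  i.1%:R^-1 * \sum_(k < i.1) q (iter k skew i.2, iter k (@shift _ R) y).

Let avg_le q1 q2 i : (forall z, q1 z <= q2 z) -> avg q1 i <= avg q2 i.
Proof.
by move=> q12; rewrite ler_wpM2l ?invr_ge0//; apply: ler_sum.
Qed.

(** Along an ultrafilter every bounded average converges, so [nu] is defined on all sets, measurable
    or not. *)
Let nu (E : set ((Theta * X) * seqspace R)) : R := lim (avg \1_E @ U).

Let avg_indic01 (E : set ((Theta * X) * seqspace R)) i : 0 <= avg \1_E i <= 1.
Proof.
apply/andP; split.
  by rewrite mulr_ge0 ?invr_ge0// sumr_ge0// => k _; rewrite indicE.
case: i => -[|n] w; rewrite /avg /=; first by rewrite invr0 mul0r.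
rewrite ler_pdivrMl// mulr1 -[leRHS]mulr1 -[n.+1 in leRHS]card_ord mulr_natl -sumr_const.
by apply: ler_sum => k _; rewrite indicE; case: (_ \in _).
Qed.

Let nu_cvg E : avg \1_E @ U --> nu E.
Proof.
have [i|p hp] := @ultra_bounded_cvg R _ U (avg \1_E) 1 UU.
  by have /andP[h1 h2] := avg_indic01 E i; rewrite ger0_norm.
by rewrite /nu (cvg_lim _ hp).
Qed.

Let nu_ge0 E : 0 <= nu E.
Proof.
apply: limr_ge; first by apply/cvg_ex; exists (nu E); exact: nu_cvg.
by apply: nearW => i; have /andP[] := avg_indic01 E i.
Qed.

Let nuU E F : E `&` F = set0 -> nu (E `|` F) = nu E + nu F.
Proof.
move=> EF; apply: cvg_lim => //.
rewrite (_ : avg \1_(E `|` F) = avg \1_E \+ avg \1_F).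
  by apply: cvgD; exact: nu_cvg.
apply/funext => i; rewrite /avg /= -mulrDr -big_split/=; congr (_ * _).
apply: eq_bigr => k _; set z := (_, _); rewrite !indicE in_setU.
have [/set_mem Ez|_] := boolP (z \in E); last by rewrite add0r.
have [/set_mem Fz|_] := boolP (z \in F); last by rewrite addr0.
by have : (E `&` F) z by []; rewrite EF.
Qed.

Let nuV B : cylinder_algebra B -> (nu (setT `*` B))%:E = V B.
Proof.
move=> [p _ <-]; rewrite -[RHS]fineK; last first.
  by rewrite fin_num_measure//; apply: measurable_cylinder_algebra; exists p.
congr EFin; apply: cvg_lim => //.
have := cvg_comp _ _ U_oo (@y_gen p); apply: cvg_trans.
apply: near_eq_cvg; apply: nearW => i; rewrite /avg/=; congr (_ * _).
apply: eq_bigr => k _; rewrite !indicE; congr (_%:R).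
by congr nat_of_bool; apply/idP/idP => /set_mem h; apply/mem_set => //; case: h.
Qed.

Let evolve (z : (Theta * X) * seqspace R) := (skew z.1, @shift _ R z.2).

(** One step of the dynamics changes an average over [n] times by two boundary terms divided by [n],
    and [n] tends to infinity along [U]. *)
Let nu_evolve E : nu (evolve @^-1` E) = nu E.
Proof.
pose g k (i : nat * (Theta * X)) : R := \1_E (iter k skew i.2, iter k (@shift _ R) y).
rewrite {1}/nu; apply: cvg_lim => //.
have -> : avg \1_(evolve @^-1` E) =
    avg \1_E \+ (fun i => i.1%:R^-1 * (g i.1 i - g 0%N i)).
  apply/funext => i; rewrite /avg /= -mulrDr; congr (_ * _).
  apply/eqP; rewrite addrA eq_sym subr_eq; apply/eqP.
  by rewrite -(big_ord_recr i.1 (fun k => g k i))/= big_ord_recl/= addrC.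
rewrite -[nu E]addr0.
apply: cvgD; first exact: nu_cvg.
have inv0 : (fun i : nat * (Theta * X) => i.1%:R^-1 : R) @ U --> (0 : R).
  apply: (cvg_comp fst (fun n => n%:R^-1 : R) U_oo).
  by rewrite -cvg_shiftS; exact: cvg_harmonic.
apply/cvgr0Pnorm_le => e e0; have /cvgr0Pnorm_le /(_ e e0) := inv0.
apply: filterS => i; apply: le_trans; rewrite normrM ler_piMr//.
rewrite ler_norml /g !indicE.
by case: (_ \in _); case: (_ \in _) => /=; apply/andP; split; lra.
Qed.

Let cptW : compact [set: Theta * X].
Proof. by case: hD => cX cT _ _; rewrite -setXTT; exact: compact_setX. Qed.

Let limit_measure : exists mu : probability (borel (Theta * X)%type * seqspace R)%type R,
  [/\ forall O B, open O -> cylinder_algebra B -> (mu (O `*` B) <= (nu (O `*` B))%:E)%E,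
      forall (O_ : nat -> set (Theta * X)) (B_ : nat -> set (seqspace R)),
        (forall k, open (O_ k)) -> (forall k, cylinder_algebra (B_ k)) ->
        (mu (\bigcup_k (O_ k `*` B_ k)) <= (nu (\bigcup_k (O_ k `*` B_ k)))%:E)%E,
      forall B, measurable B -> mu (setT `*` B) = V B &
      forall A : set (borel (Theta * X)%type * seqspace R), measurable A ->
        mu (evolve @^-1` A) = mu A].
Proof.
have [mu [h1 h2 h3 h4]] := @content_extension R
  ((Theta * X)%type : ptopologicalType) _ (seqspace R) V
  (@cylinder_algebra R) nu cptW (@open_superlevel R _) (@cylinder_algebraT R)
  (@cylinder_algebraI R) (@cylinder_algebraC R) (@measurable_cylinder_algebra R)
  (@cylinder_algebra_generates R) nu_ge0 nuU nuV.
exists mu; split => // A mA.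
have mevolve : measurable_fun setT
    (evolve : borel (Theta * X)%type * seqspace R -> borel (Theta * X)%type * seqspace R).
  apply: measurable_fun_pair.
    apply: measurableT_comp (continuous_borel_measurable continuous_skew) _.
    exact: measurable_fst.
  by apply: measurableT_comp (@measurable_shift _ R) _; exact: measurable_snd.
have le_mu B : (mu (evolve @^-1` B) <= mu B)%E.
  apply: h4 => O C oO AC; exists (skew @^-1` O), (@shift _ R @^-1` C); split.
  - by move/continuousP: continuous_skew; exact.
  - exact: cylinder_algebra_shift.
  - by [].
  - by rewrite (_ : _ `*` _ = evolve @^-1` (O `*` C))// nu_evolve.
apply/eqP; rewrite eq_le le_mu/=.
have mEA : measurable (evolve @^-1` A : set (borel (Theta * X)%type * seqspace R)).
  by rewrite -[_ @^-1` _]setTI; exact: mevolve.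
(* The same inequality for the complement gives the converse. *)
have := le_mu (~` A); rewrite preimage_setC probability_setC//.
rewrite probability_setC//.
have : mu A \is a fin_num by exact: fin_num_measure.
have : mu (evolve @^-1` A) \is a fin_num by exact: fin_num_measure.
by case: (mu _) (mu _) => [v| |] [x| |]//= _ _; rewrite -!EFinB !lee_fin lerD2l lerN2.
Qed.

Let Z := (borel (Theta * X)%type * seqspace R)%type.

Let measurable_T u : measurable_fun setT (T u : borel X -> borel X).
Proof.
apply: continuous_borel_measurable => x.
case: hD => _ _ cT _; apply: (@continuous_comp _ _ _ (fun x => (u, x)) (fun z => T z.1 z.2)).
  by apply: cvg_pair; [exact: cvg_cst|exact: cvg_id].
exact: cT.
Qed.

Lemma measurable_observations u :
  measurable_fun setT (observations T f u : borel X -> seqspace R).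
Proof.
apply: (@measurability _ _ (borel X) (seqspace R) _ _ (@cylinders _ R)) => //.
move=> _ [_ [k [B [mB ->]]] <-].
have mk : measurable_fun setT ((fun x => obs (iter k skew (u, x))) : borel X -> R).
  apply: continuous_borel_measurableR => x.
  apply: (@continuous_comp _ _ _ (fun x => iter k skew (u, x))); last exact: continuous_obs.
  apply: (@continuous_comp _ _ _ (fun x => (u, x))); last exact: continuous_iter_skew.
  by apply: cvg_pair; [exact: cvg_cst|exact: cvg_id].
have := mk measurableT B mB; congr measurable; congr (_ `&` _).
by apply/seteqP; split => x /=; rewrite /obs iter_skew.
Qed.

Let Phi (z : Z) : seqspace (R * R)%type := fun k => (obs (iter k skew z.1), z.2 k).

Let measurable_coord k : measurable_fun setT (fun z : Z => z.2 k).
Proof.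
apply: (@measurableT_comp _ _ _ _ _ _ (fun v : seqspace R => v k)).
  move=> _ B mB; rewrite setTI; apply: sub_sigma_algebra.
  by exists k, B.
exact: measurable_snd.
Qed.

Let measurable_obs k : measurable_fun setT (fun z : Z => obs (iter k skew z.1)).
Proof.
apply: (@measurableT_comp _ _ _ _ _ _
  ((fun w => obs (iter k skew w)) : borel (Theta * X)%type -> R)); last exact: measurable_fst.
apply: continuous_borel_measurableR => w.
by apply: continuous_comp; [exact: continuous_iter_skew|exact: continuous_obs].
Qed.

Let measurable_Phi : measurable_fun setT Phi.
Proof.
apply: (@measurability _ _ Z (seqspace (R * R)%type) _ _ (@cylinders _ (R * R)%type)) => //.
move=> _ [_ [k [B [mB ->]]] <-].
by apply: (measurable_fun_pair (measurable_obs k) (measurable_coord k)).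
Qed.

Let measurable_point : measurable_fun setT ((fun z : Z => z.1.2) : Z -> borel X).
Proof.
apply: (@measurableT_comp _ _ _ _ _ _ (snd : borel (Theta * X)%type -> borel X)).
  by apply: continuous_borel_measurable => w; exact: cvg_snd.
exact: measurable_fst.
Qed.

Let parameter_law (mu : probability Z R) :
  (forall O B, open O -> cylinder_algebra B -> (mu (O `*` B) <= (nu (O `*` B))%:E)%E) ->
  {ae mu, forall z : Z, z.1.1 = t}.
Proof.
move=> mu_le.
(* Taking the complement of a closure makes [far j] open, as the bound of [mu] by [nu] requires;
   eventually the parameters along [U] avoid it. *)
pose far j : set (Theta * X) := fst @^-1` (~` closure (ball t (j.+1%:R^-1 : R))).
have o_far j : open (far j).
  apply: open_comp => [w _|]; first exact: cvg_fst.
  by rewrite openC; exact: closed_closure.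
have far0 j : {ae mu, forall z : Z, ~ far j z.1}.
  exists (far j `*` setT); split => [||z /=].
  - by apply: measurableX => //; exact: sub_sigma_algebra.
  - apply/eqP; rewrite eq_le measure_ge0 andbT.
    apply: le_trans (mu_le _ _ (o_far j) (@cylinder_algebraT R)) _.
    rewrite lee_fin le_eqVlt; apply/orP; left; apply/eqP.
    apply: cvg_lim => //; apply: cvg_near_cst.
    have : \forall i \near U, ball t (j.+1%:R^-1 : R) i.2.1.
      by apply: U_t; apply: nbhsx_ballx; rewrite invr_gt0.
    apply: filterS => i hi; rewrite /avg big1 ?mulr0// => k _.
    rewrite indicE memNset// => -[] /=; rewrite /far/= iter_skew /= => h _.
    by apply: h; exact: subset_closure.
  - by move=> /contrapT.
have := ae_foralln far0; apply: filterS => z hz; apply/eqP; rewrite eq_sym.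
rewrite -[_ == _]negbK -(@mdist_gt0 R); apply/negP => d0.
(* Half the distance: a point common to balls of this radius around [t] and [z.1.1] would violate
   the triangle inequality. *)
have [j _ /(_ j (leqnn j)) jd] :=
  near_infty_natSinv_lt (PosNum (divr_gt0 d0 (ltr0n R 2))).
apply: (hz j) => /(_ (ball z.1.1 (j.+1%:R^-1 : R))).
have j0 : 0 < j.+1%:R^-1 :> R by rewrite invr_gt0.
move=> /(_ (nbhsx_ballx _ _ j0)) [x [tx zx]].
have := ball_triangle tx (ball_sym zx); rewrite ballEmdist/=.
by move: jd; rewrite /= ltr_pdivlMr// mulr_natr mulr2n => h1 /lt_trans/(_ h1); rewrite ltxx.
Qed.

Let cost (z : Z) : R := l (obs z.1, z.2 0%N).

Let measurable_cost : measurable_fun setT cost.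
Proof.
apply: measurableT_comp (lower_semicontinuous_plane_measurable l_lsc) _.
exact: (measurable_fun_pair (measurable_obs 0) (measurable_coord 0)).
Qed.

Let superlevel c : set Z := [set z | c < cost z].

(* A superlevel set is a countable union of rectangles by lower semicontinuity. *)
Let cost_superlevel (mu : probability Z R) (c : R) :
  (forall (O_ : nat -> set (Theta * X)) (B_ : nat -> set (seqspace R)),
     (forall k, open (O_ k)) -> (forall k, cylinder_algebra (B_ k)) ->
     (mu (\bigcup_k (O_ k `*` B_ k)) <= (nu (\bigcup_k (O_ k `*` B_ k)))%:E)%E) ->
  (mu (superlevel c) <= (nu (superlevel c))%:E)%E.
Proof.
move=> mu_le; have /lower_semicontinuousP /(_ c) := l_lsc.
move=> /open_plane_boxes[P [q [j [oP E]]]].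
have -> : superlevel c =
    \bigcup_k ((obs @^-1` P k) `*` cylinder_set (CylBall (0%N, q k, j k))).
  apply/seteqP; split => z.
    move=> cz; have : [set z | c%:E < (l z)%:E]%E (obs z.1, z.2 0%N).
      by rewrite /= lte_fin.
    by rewrite E => -[k _ [/= h1 h2]]; exists k.
  move=> [k _ [h1 h2]]; have : [set z | c%:E < (l z)%:E]%E (obs z.1, z.2 0%N).
    by rewrite E; exists k.
  by rewrite /= lte_fin.
apply: mu_le => k; last by exists (CylBall (0%N, q k, j k)).
by apply: open_comp => // w _; exact: continuous_obs.
Qed.

(** A layer-cake sum from below, stopped after [K] steps: a finite combination of superlevel
    indicators, to which finite additivity of [nu] applies. *)
Let staircase (delta : R) K (x : R) := \sum_(j < K) delta * ((delta * j.+1%:R < x)%R : nat)%:R.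

Let staircase_le delta K x : 0 < delta -> 0 <= x -> staircase delta K x <= x.
Proof.
move=> d0 x0.
suff : staircase delta K x <= x /\ staircase delta K x <= delta * K%:R by case.
elim: K => [|K [IH1 IH2]]; first by rewrite /staircase big_ord0 mulr0.
rewrite /staircase big_ord_recr/= -/(staircase delta K x).
case: (ltP (delta * K.+1%:R) x) => h; rewrite ?mulr1 ?mulr0 ?addr0; last first.
  by split => //; apply: le_trans IH2 _; rewrite ler_pM2l// ler_nat.
move: h IH2; rewrite -natr1 mulrDr mulr1 => h IH2; split; lra.
Qed.

Let staircase_ge delta x : 0 < delta -> 0 <= x ->
  exists K, x <= delta + staircase delta K x.
Proof.
move=> d0 x0.
have : exists K : nat, x <= delta * K.+1%:R.
  have xd : 0 <= x / delta by rewrite divr_ge0// ltW.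
  exists (Num.bound (x / delta)); rewrite mulrC -ler_pdivrMr//.
  by apply: le_trans (ltW (archi_boundP xd)) _; rewrite ler_nat.
move=> /ex_minnP[K xK K_min]; exists K.
suff -> : staircase delta K x = delta * K%:R.
  by move: xK; rewrite -natr1 mulrDr mulr1 addrC.
rewrite /staircase (eq_bigr (fun=> delta)) ?sumr_const ?card_ord ?mulr_natr//.
move=> j _; have [//|h] := ltP (delta * j.+1%:R) x; first by rewrite mulr1.
by have := K_min _ h; rewrite leqNgt ltn_ord.
Qed.

(** A Fatou-type bound. Each finite staircase lies below the cost, so its average is at most [r] and
    this passes to [nu], hence to [mu]. The full series of layers misses the cost by at most
    [delta]. *)
Let integral_cost_le (mu : probability Z R) (r : R) :
  (forall (O_ : nat -> set (Theta * X)) (B_ : nat -> set (seqspace R)),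
     (forall k, open (O_ k)) -> (forall k, cylinder_algebra (B_ k)) ->
     (mu (\bigcup_k (O_ k `*` B_ k)) <= (nu (\bigcup_k (O_ k `*` B_ k)))%:E)%E) ->
  (\forall i \near U, avg cost i <= r) ->
  (\int[mu]_z (cost z)%:E <= r%:E)%E.
Proof.
move=> mu_le avg_r; apply/lee_addgt0Pr => delta d0.
have cost0 z : 0 <= cost z by exact: l_ge0.
pose G j := superlevel (delta * j.+1%:R).
have mG j : measurable (G j : set Z).
  rewrite (_ : G j = cost @^-1` `]delta * j.+1%:R, +oo[%classic).
    by rewrite -[_ @^-1` _]setTI; exact: measurable_cost.
  by apply/seteqP; split => z /=; rewrite in_itv/= andbT.
have stairE K z : staircase delta K (cost z) = \sum_(j < K) delta * \1_(G j) z.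
  apply: eq_bigr => j _; rewrite indicE; congr (_ * (nat_of_bool _)%:R).
  by apply/idP/idP => [h|/set_mem//]; exact/mem_set.
have le_r K : (\sum_(j < K) delta%:E * mu (G j) <= r%:E)%E.
  apply: (@le_trans _ _ (\sum_(j < K) delta * nu (G j))%:E).
    rewrite -sumEFin; apply: lee_sum => j _; rewrite EFinM.
    by apply: lee_wpmul2l; [rewrite lee_fin ltW|exact: cost_superlevel].
  have cvgK : (fun i => \sum_(j < K) delta * avg \1_(G j) i) @ U -->
      \sum_(j < K) delta * nu (G j).
    apply: cvg_big => [|j _]; first exact: add_continuous.
    apply: cvgM; first exact: cvg_cst.
    exact: nu_cvg.
  rewrite lee_fin -(cvg_lim _ cvgK)//; apply: limr_le.
    by apply/cvg_ex; eexists; exact: cvgK.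
  apply: filterS avg_r => i; apply: le_trans.
  rewrite (_ : \sum_(j < K) _ = avg (fun z => staircase delta K (cost z)) i).
    by apply: avg_le => z; exact: staircase_le.
  rewrite /avg; under [in RHS]eq_bigr do rewrite stairE.
  rewrite exchange_big/= mulr_sumr; apply: eq_bigr => j _.
  by rewrite -mulr_sumr mulrCA.
have -> : (r%:E + delta%:E = delta%:E + r%:E)%E by rewrite addeC.
apply: (@le_trans _ _ (\int[mu]_z (delta%:E + \sum_(j <oo) delta%:E * (\1_(G j) z)%:E))%E).
  apply: ge0_le_integral => //.
  - by move=> z _; rewrite lee_fin.
  - by apply/measurable_EFinP.
  - apply: emeasurable_funD => //; apply: ge0_emeasurable_sum.
      by move=> j z _ _; rewrite mule_ge0// ?lee_fin ?ltW// indicE.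
    move=> j _; apply: emeasurable_funM => //.
    by apply/measurable_EFinP; exact: measurable_indic.
  - move=> z _; have [K hK] := staircase_ge d0 (cost0 z).
    apply: (@le_trans _ _ (delta + staircase delta K (cost z))%:E).
      by rewrite lee_fin.
    rewrite EFinD leeD2l// stairE -sumEFin.
    apply: le_trans (nneseries_lim_ge K _); last first.
      by move=> j _ _; rewrite mule_ge0// ?lee_fin ?ltW// indicE.
    by rewrite big_mkord; apply: lee_sum => j _; rewrite EFinM.
rewrite ge0_integralD//; last 3 first.
- by move=> z _; rewrite lee_fin ltW.
- by move=> z _; apply: nneseries_ge0 => j _ _; rewrite mule_ge0// ?lee_fin ?ltW// indicE.
- apply: ge0_emeasurable_sum.
    by move=> j z _ _; rewrite mule_ge0// ?lee_fin ?ltW// indicE.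
  move=> j _; apply: emeasurable_funM => //.
  by apply/measurable_EFinP; exact: measurable_indic.
rewrite integral_cst// (_ : (_ * _)%E = delta%:E) ?leeD2l//; last first.
  by rewrite -[RHS]mule1; congr (_ * _)%E; exact: probability_setT.
rewrite integral_nneseries//; last 2 first.
- move=> j; apply: emeasurable_funM => //.
  by apply/measurable_EFinP; exact: measurable_indic.
- by move=> j z _; rewrite mule_ge0// ?lee_fin ?ltW// indicE.
apply: lime_le.
  apply: is_cvg_nneseries => j _ _; apply: integral_ge0 => z _.
  by rewrite mule_ge0// ?lee_fin ?ltW// indicE.
apply: nearW => K; rewrite big_mkord; apply: le_trans (le_r K).
apply: lee_sum => j _; rewrite ge0_integralZl_EFin//.
- by rewrite integral_indic// setIT.
- by apply/measurable_EFinP; exact: measurable_indic.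
- exact: ltW.
Qed.

(** The joining is chosen before [r], so that its cost can be bounded by every [r] of a sequence at
    once. *)
Lemma ultrafilter_joining : exists2 U0, processes T f t U0 &
  exists2 J, joinings U0 V J & forall r : R,
    (\forall i \near U,
      \sum_(k < i.1) l (f i.2.1 (iter k (T i.2.1) i.2.2), y k) <= r * i.1%:R) ->
    (\int[J]_z (l (z 0%N))%:E <= r%:E)%E.
Proof.
have [mu [mu_rect mu_rects mu_snd mu_evolve]] := limit_measure.
have mu_t := parameter_law mu_rect.
pose mX := image_law measurable_point (probability_setT mu).
pose U0 := image_law (measurable_observations t) (probability_setT mX).
pose J := image_law measurable_Phi (probability_setT mu).
have pre_point A : measurable A -> measurable ((fun z : Z => z.1.2) @^-1` (A : set (borel X))).
  by move=> mA; rewrite -[_ @^-1` _]setTI; exact: measurable_point.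
exists U0.
  exists mX => // A mA.
  have mTA : measurable (T t @^-1` A : set (borel X)).
    by rewrite -[_ @^-1` _]setTI; exact: measurable_T.
  transitivity (mu (evolve @^-1` ((fun z : Z => z.1.2) @^-1` A))); last first.
    by apply: mu_evolve; exact: pre_point.
  transitivity (mu ((fun z : Z => z.1.2) @^-1` (T t @^-1` A))); first by [].
  (* The second component of [skew] is [T t] almost surely, since the parameter is almost surely
     [t]. *)
  apply: (@eq_measure_ae _ Z _ mu).
  - exact: pre_point.
  - have mTz : measurable_fun setT ((fun z : Z => T z.1.1 z.1.2) : Z -> borel X).
      apply: (@measurableT_comp _ _ _ _ _ _
        ((fun w => T w.1 w.2) : borel (Theta * X)%type -> borel X)); last exact: measurable_fst.
      by apply: continuous_borel_measurable; case: hD.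
    have := mTz measurableT A mA; rewrite setTI; exact.
  - by apply: filterS mu_t => -[[u x] v] /= ->.
exists J.
  split.
  - move=> A mA.
    transitivity (mu (evolve @^-1` (Phi @^-1` A))); last first.
      by apply: mu_evolve; rewrite -[_ @^-1` _]setTI; exact: measurable_Phi.
    have PhiE z : Phi (evolve z) = @shift _ _ (Phi z).
      by apply/funext => k; rewrite /Phi /shift iterSr.
    rewrite /pushforward /J /image_law /pushforward; congr (mu _).
    by apply/seteqP; split => z; rewrite /preimage [X in _ -> X]/= /mkset PhiE.
  - move=> A mA.
    have mo : measurable (observations T f t @^-1` A : set (borel X)).
      by rewrite -[_ @^-1` _]setTI; exact: measurable_observations.
    transitivity (mu ((fun z : Z => z.1.2) @^-1` (observations T f t @^-1` A))); last by [].
    transitivity (mu [set z : Z | A (fun k => obs (iter k skew z.1))]); first by [].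
    apply: (@eq_measure_ae _ Z _ mu).
    + have mo' : measurable_fun setT
          ((fun z k => obs (iter k skew z.1)) : Z -> seqspace R).
        apply: (@measurability _ _ Z (seqspace R) _ _ (@cylinders _ R)) => //.
        by move=> _ [_ [k [B [mB ->]]] <-]; exact: (measurable_obs k).
      have := mo' measurableT A mA; rewrite setTI; exact.
    + exact: pre_point.
    + apply: filterS mu_t => -[[u x] v] /= ->; rewrite /observations /obs.
      by under eq_fun do rewrite iter_skew.
  - move=> A mA; rewrite -(mu_snd _ mA).
    rewrite /pushforward /J /image_law /pushforward; congr (mu _).
    by apply/seteqP; split => -[w v] //= [].
move=> r hr.
have mcoord0 : measurable_fun setT ((fun z => (l (z 0%N))%:E) : seqspace (R * R)%type -> \bar R).
  apply/measurable_EFinP.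
  apply: measurableT_comp (lower_semicontinuous_plane_measurable l_lsc) _.
  move=> _ B mB; rewrite setTI; apply: sub_sigma_algebra.
  by exists 0%N, B.
rewrite ge0_integral_image_law//; last by move=> z; rewrite lee_fin.
apply: integral_cost_le mu_rects _.
have : \forall i \near U, (0 < i.1)%N := U_oo (nbhs_infty_gt 0).
apply: filterS2 hr => i hi i0; rewrite /avg ler_pdivrMl ?ltr0n// mulrC.
apply: le_trans hi; rewrite le_eqVlt; apply/orP; left; apply/eqP.
apply: eq_bigr => k _; rewrite /cost/= /obs iter_skew/=.
by rewrite iter_shift addn0.
Qed.

End along_ultrafilter.

Lemma limit_joining (F : set_system (nat * (Theta * X))) (t : Theta)
    (y : seqspace R) : ProperFilter F -> fst @ F --> \oo ->
  (fun i => i.2.1) @ F --> t -> generic V y ->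
  exists2 U0, processes T f t U0 &
  exists2 J, joinings U0 V J & forall r : R,
    (\forall i \near F,
      \sum_(k < i.1) l (f i.2.1 (iter k (T i.2.1) i.2.2), y k) <= r * i.1%:R) ->
    (\int[J]_z (l (z 0%N))%:E <= r%:E)%E.
Proof.
move=> FF F_oo F_t y_gen; have [U [UU FU]] := ultraFilterLemma FF.
have [U0 U0_t [J J_join hJ]] := @ultrafilter_joining U t y UU
  (cvg_trans (cvg_app fst FU) F_oo) (cvg_trans (cvg_app _ FU) F_t) y_gen.
exists U0 => //; exists J => // r hr.
by apply: hJ; apply: FU.
Qed.

End limit_joining.

(** * Optimal joinings bound the minimal risk from above *)

Section sequence_neighbourhoods.
Variable R : realType.

(** The neighbourhood filter of the product topology, whose open sets are the [finitely_open]
    ones. *)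
Definition nbhs_seq (v : nat -> R) : set_system (nat -> R) :=
  filter_from [set p : nat * R | 0 < p.2]
    (fun p => [set v' | forall k, (k < p.1)%N -> `|v' k - v k| < p.2]).

Global Instance nbhs_seq_filter v : Filter (nbhs_seq v).
Proof.
apply: filter_from_filter; first by exists (0%N, 1) => /=.
move=> [n e] [m e'] /= e0 e'0; exists (maxn n m, Num.min e e').
  by rewrite /= lt_min e0.
move=> v' /= h; split => k kn.
  by have := h k; rewrite leq_max kn lt_min => /(_ isT)/andP[].
by have := h k; rewrite leq_max kn orbT lt_min => /(_ isT)/andP[].
Qed.

Lemma cvg_nbhs_seq v k : (fun v' : nat -> R => v' k) @ nbhs_seq v --> v k.
Proof.
apply/cvgrPdist_lt => e e0; exists (k.+1, e) => // v' h /=.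
by rewrite distrC; exact: h.
Qed.

Lemma finitely_open_nbhs (A : set (nat -> R)) :
  (forall v, A v -> nbhs_seq v A) -> finitely_open A.
Proof. by move=> hA v /hA[[n e] /= e0 h]; exists n, e. Qed.

(** The tube lemma. It makes sets defined by an uncountable quantifier over states measurable. *)
Lemma finitely_open_forall (X : topologicalType) (P : (nat -> R) -> X -> Prop) :
  compact [set: X] ->
  (forall v (x : X), (forall x, P v x) -> 
     filter_prod (nbhs x) (nbhs_seq v) (fun p => P p.2 p.1)) ->
  finitely_open [set v | forall x, P v x].
Proof.
move=> /compact_near_coveringP cX hP; apply: finitely_open_nbhs => v Pv.
apply: filterS (cX _ (nbhs_seq v) P _ (fun x _ => hP v x Pv)) => v' h x.
exact: (h x I).
Qed.

End sequence_neighbourhoods.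

Lemma ae_pushforward d d' (S1 : measurableType d) (S2 : measurableType d')
    (R : realType) (Q1 : probability S1 R) (Q2 : probability S2 R) (g : S1 -> S2)
    (P : S2 -> Prop) : measurable_fun setT g ->
  (forall A, measurable A -> pushforward Q1 g A = Q2 A) ->
  {ae Q2, forall v, P v} -> {ae Q1, forall u, P (g u)}.
Proof.
move=> mg gE [N [mN N0 PN]]; exists (g @^-1` N); split.
- by rewrite -[_ @^-1` _]setTI; exact: mg.
- by rewrite -N0; exact: gE.
- by move=> u /= h; exact: PN.
Qed.

Lemma measurable_seq_comp d d' (S1 : measurableType d)
    (S2 : measurableType d') (g : S1 -> S2) : measurable_fun setT g ->
  measurable_fun setT ((fun z k => g (z k)) : seqspace S1 -> seqspace S2).
Proof.
move=> mg; apply: (@measurability _ _ (seqspace S1) (seqspace S2) _ _ (@cylinders _ S2)) => //.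
move=> _ [_ [k [B [mB ->]]] <-]; rewrite setTI; apply: sub_sigma_algebra.
by exists k, (g @^-1` B); split => //; rewrite -[_ @^-1` _]setTI; exact: mg.
Qed.

Section upper_bound.
Context (R : realType) (X Theta : pmetricType R).
Variables (T : Theta -> X -> X) (f : Theta -> X -> R).
Hypothesis hD : continuous_family T f.
Variables (l : R * R -> R).
Hypotheses (l_ge0 : forall z, 0 <= l z)
  (l_lsc : lower_semicontinuous (fun z : R * R => (l z)%:E)).
Variable V : probability (seqspace R) R.
Hypotheses (V_stationary : stationary V) (V_ergodic : ergodic V).
Variable t : Theta.

Let continuous_observation k : continuous (fun x => observations T f t x k).
Proof.
move=> x; have -> : (fun x => observations T f t x k) =
    (fun w => f w.1 w.2) \o (iter k (skew T) \o (fun x => (t, x))).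
  by apply/funext => x'; rewrite /= iter_skew.
case: (hD) => _ _ _ cf.
apply: continuous_comp; last exact: cf.
apply: continuous_comp; last exact: (continuous_iter_skew hD).
by apply: cvg_pair; [exact: cvg_cst|exact: cvg_id].
Qed.

Let cptX : compact [set: X]. Proof. by case: hD. Qed.

Let sum_loss n (x : X) (v : nat -> R) : R :=
  \sum_(k < n) l (f t (iter k (T t) x), v k).

Let measurable_all_above n (c : R) :
  measurable ([set v | forall x, c < sum_loss n x v] : set (seqspace R)).
Proof.
apply: measurable_finitely_open; apply: finitely_open_forall cptX _ => v x hc.
have [n0|n0] := posnP n.
  apply: (@filterE _ (filter_prod (nbhs x) (nbhs_seq v))) => -[x' v'] /=.
  by move: (hc x); rewrite /sum_loss n0 !big_ord0.
(* The excess over [c] is shared equally among the [n] terms, each of which may drop by less than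
   [e] near [(x, v)]; hence the separate case of no term. *)
pose e := (sum_loss n x v - c) / n%:R.
have nr0 : 0 < n%:R :> R by rewrite ltr0n.
have e0 : 0 < e by rewrite divr_gt0// subr_gt0.
have : filter_prod (nbhs x) (nbhs_seq v) (fun p => forall k : 'I_n,
    l (f t (iter k (T t) x), v k) - e < l (f t (iter k (T t) p.1), p.2 k)).
  apply: (@filter_forall _ _ _ (filter_prod (nbhs x) (nbhs_seq v))) => k.
  have [|B nB hB] := @l_lsc (f t (iter k (T t) x), v k)
    (l (f t (iter k (T t) x), v k) - e).
    by rewrite lte_fin ltrBlDr ltrDl.
  have : (fun p : X * (nat -> R) => (f t (iter k (T t) p.1), p.2 k)) @
      filter_prod (nbhs x) (nbhs_seq v) --> (f t (iter k (T t) x), v k).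
    apply: (@cvg_pair _ _ _ (filter_prod (nbhs x) (nbhs_seq v))
      (nbhs (f t (iter k (T t) x))) (nbhs (v k))).
      exact: (cvg_comp fst (fun x => observations T f t x k) cvg_fst
        (@continuous_observation k x)).
    exact: (cvg_comp snd (fun v' : nat -> R => v' k) cvg_snd (@cvg_nbhs_seq _ v k)).
  move=> /(_ _ nB); apply: (@filterS _ (filter_prod (nbhs x) (nbhs_seq v))) => p /= Bp.
  by have := hB _ Bp; rewrite lte_fin.
apply: (@filterS _ (filter_prod (nbhs x) (nbhs_seq v))) => p hp; rewrite /sum_loss.
apply: (@le_lt_trans _ _ (\sum_(k < n) (l (f t (iter k (T t) x), v k) - e))).
  rewrite sumrB sumr_const card_ord -mulr_natr /e divfK ?gt_eqF//.
  by rewrite opprB addrC subrK.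
by apply: ltr_sum => //; apply/hasP; exists (Ordinal n0); rewrite ?mem_index_enum.
Qed.

(** The first coordinate of a joining lies here almost surely. By compactness of [X] the set is
    closed for the product topology, hence measurable. *)
Let range_observations : set (seqspace R) := range (observations T f t : X -> seqspace R).

Let measurable_range : measurable range_observations.
Proof.
rewrite -[range_observations]setCK; apply: measurableC.
rewrite (_ : ~` _ = [set v | forall x, v <> observations T f t x]); last first.
  apply/seteqP; split => v h; first by move=> x vx; apply: h; exists x.
  by move=> [x _ xv]; exact: (h x).
apply: measurable_finitely_open; apply: finitely_open_forall cptX _ => v x hv.
have [k vk] : exists k, v k <> observations T f t x k.
  apply: contrapT => /forallNP h; apply: (hv x); apply/funext => k.
  exact: contrapT (h k).
have d0 : 0 < `|v k - observations T f t x k| / 2.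
  by rewrite divr_gt0// normr_gt0 subr_eq0; apply/eqP.
have h1 : filter_prod (nbhs x) (nbhs_seq v) (fun p =>
    `|observations T f t x k - observations T f t p.1 k| <
      `|v k - observations T f t x k| / 2).
  have : (fun p : X * (nat -> R) => observations T f t p.1 k) @
      filter_prod (nbhs x) (nbhs_seq v) --> observations T f t x k.
    exact: (cvg_comp fst (fun x => observations T f t x k) cvg_fst
      (@continuous_observation k x)).
  by move/cvgrPdist_lt; apply.
have h2 : filter_prod (nbhs x) (nbhs_seq v) (fun p =>
    `|v k - p.2 k| < `|v k - observations T f t x k| / 2).
  have : (fun p : X * (nat -> R) => p.2 k) @
      filter_prod (nbhs x) (nbhs_seq v) --> v k.
    exact: (cvg_comp snd (fun v' : nat -> R => v' k) cvg_snd (@cvg_nbhs_seq _ v k)).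
  by move/cvgrPdist_lt; apply.
apply: (@filterS2 _ (filter_prod (nbhs x) (nbhs_seq v)) _ _ _ _ _ h1 h2) => p /= near1 near2 pE.
have : `|v k - observations T f t x k| < `|v k - observations T f t x k|.
  rewrite [ltRHS]splitr -{1}(subrKA (p.2 k)).
  apply: le_lt_trans (ler_normD _ _) _; apply: ltrD => //.
  by rewrite distrC pE.
by rewrite ltxx.
Qed.

(** The constant [M] depends on the path and is absorbed later by a slightly larger [c]; the null
    set depends on [t]. *)
Lemma ergodic_upper_bound U0 J (c : R) : processes T f t U0 -> joinings U0 V J ->
  (\int[J]_z (l (z 0%N))%:E < c%:E)%E ->
  {ae V, forall v : seqspace R, exists M : nat, forall n, exists x,
    \sum_(k < n.+1) l (f t (iter k (T t) x), v k) <= c * n.+1%:R + M%:R}.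
Proof.
move=> [mX mX_inv U0E] [J_stat J1 J2] Jc.
pose A n (M : nat) : set (seqspace R) :=
  [set v | forall x, c * n.+1%:R + M%:R < sum_loss n.+1 x v].
suff : {ae V, forall v, exists M, forall n, ~ A n M v}.
  apply: filterS => v [M hM]; exists M => n.
  have /existsNP[x /negP] := hM n; rewrite -leNgt; by exists x.
apply: (@ae_eventually_not _ _ _ V (@shift _ R) (@measurable_shift _ R) V_stationary
  A (Num.bound `|c|)) => // [n M|n M v /= hA x|hA].
- exact: measurable_all_above.
(* Dropping the first term passes from [x] to [T t x] and from the path to its shift. *)
- have -> : sum_loss n.+2 x v = l (f t x, v 0%N) + sum_loss n.+1 (T t x) (@shift _ R v).
    rewrite /sum_loss big_ord_recl; congr (_ + _); apply: eq_bigr => k _.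
    by rewrite /shift -iterSr.
  have := hA (T t x); have := archi_boundP (normr_ge0 c).
  have := l_ge0 (f t x, v 0%N); have := ler_norm c.
  rewrite natrD -[n.+2%:R]natr1 mulrDr mulr1; lra.
suff : (c%:E <= \int[J]_z (l (z 0%N))%:E)%E by rewrite leNgt Jc.
have mfst := measurable_seq_comp (@measurable_fst _ _ R R).
have msnd := measurable_seq_comp (@measurable_snd _ _ R R).
have hsnd := ae_pushforward msnd J2 hA.
have U0range : {ae U0, forall u, range_observations u}.
  apply/ae_probability1 => //; rewrite U0E// /pushforward.
  rewrite (_ : _ @^-1` _ = setT) ?probability_setT//.
  by rewrite -subTset => x _ /=; exists x.
have hfst := ae_pushforward mfst J1 U0range.
apply: (@maximal_inequality _ _ _ J (@shift _ _) _ J_stat (fun z => l (z 0%N)) c).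
- exact: measurable_shift.
- apply: measurableT_comp (lower_semicontinuous_plane_measurable l_lsc) _.
  move=> _ B mB; rewrite setTI; apply: sub_sigma_algebra.
  by exists 0%N, B.
- by move=> z; exact: l_ge0.
(* Excess zero suffices here: the first coordinate is an orbit, and along the second one every orbit
   averages above [c] at a common time. *)
- apply: filterS2 hfst hsnd => z [x _ xz] /(_ 0%N)[n]; rewrite /A /= addr0 => /(_ x)/ltW h.
  exists n.+1 => //; apply: le_trans h _; rewrite /sum_loss.
  rewrite le_eqVlt; apply/orP; left; apply/eqP; apply: eq_bigr => k _.
  rewrite iter_shift addn0; congr l; rewrite [RHS]surjective_pairing; congr pair.
  by have := congr1 (fun u : nat -> R => u k) xz.
Qed.

End upper_bound.

(** * Minimal cost, minimal risk and their convergence *)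

Lemma ae_exists d (S : measurableType d) (R : realType) (Q : probability S R)
  (P : S -> Prop) : {ae Q, forall v, P v} -> exists v, P v.
Proof.
move=> QP; apply: contrapT => /forallNP nP.
have : {ae Q, forall v, (set0 : set S) v} by apply: filterS QP => v /nP.
move=> /(ae_probability1 Q measurable0); rewrite measure0 => -[] /eqP.
by rewrite eq_sym oner_eq0.
Qed.

Section minimal_cost.
Context (R : realType) (X Theta : pmetricType R).
Variables (T : Theta -> X -> X) (f : Theta -> X -> R).
Hypothesis hD : continuous_family T f.
Variables (l : R * R -> R).
Hypotheses (l_ge0 : forall z, 0 <= l z)
  (l_lsc : lower_semicontinuous (fun z : R * R => (l z)%:E)).
Variable V : probability (seqspace R) R.
Hypotheses (V_stationary : stationary V) (V_ergodic : ergodic V).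

Let m t := min_gamma T f l V t.

Let total (y : nat -> R) n t x : R := \sum_(k < n) l (f t (iter k (T t) x), y k).

Lemma min_gamma_ge0 t : (0 <= m t)%E.
Proof.
apply: le_ereal_inf_tmp => _ [U0 _ <-]; apply: le_ereal_inf_tmp => _ [J _ <-].
by apply: integral_ge0 => z _; rewrite lee_fin.
Qed.

Lemma total_near_le t (c : R) : (m t < c%:E)%E ->
  {ae V, forall y : seqspace R,
    \forall n \near \oo, exists x, total y n t x <= c * n%:R}.
Proof.
(* The room between [c0] and [c] absorbs the constant [M] for large [n]. *)
move=> mc; have [c0 mc0 c0c] : exists2 c0 : R, (m t < c0%:E)%E & c0 < c.
  have := min_gamma_ge0 t; move: mc; rewrite -/(m t); case: (m t) => [a| |]//.
  rewrite lte_fin => ac _; exists ((a + c) / 2); last by rewrite midf_lt.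
  by rewrite lte_fin midf_lt.
have [_ [U0 U0t <-] /ereal_inf_lt [_ [J JJ <-] Jc0]] := ereal_inf_lt mc0.
have := ergodic_upper_bound hD l_ge0 l_lsc V_stationary V_ergodic U0t JJ Jc0.
apply: filterS => y [M hM]; near=> n.
have n0 : (0 < n)%N by near: n; exact: nbhs_infty_gt.
have [x] := hM n.-1; rewrite prednK// => hx; exists x; apply: le_trans hx _.
rewrite -lerBrDl -mulrBl mulrC -ler_pdivrMr ?subr_gt0//.
by near: n; exact: nbhs_infty_ger.
Unshelve. all: by end_near. Qed.

(** Were it false, triples of a time, a parameter and a state with small total would exist
    arbitrarily close to [\oo] and [t], and the limit joining along the filter of such triples would
    cost at most [r]. *)
Lemma total_near_gt t (r : R) (y : seqspace R) : generic V y -> (r%:E < m t)%E ->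
  filter_prod (nbhs t) \oo (fun p : Theta * nat =>
    forall x, r * p.2%:R < total y p.2 p.1 x).
Proof.
move=> y_gen rm; apply: contrapT => nfar.
pose A (Q : set (Theta * nat)) : set (nat * (Theta * X)) :=
  [set i | Q (i.2.1, i.1) /\ total y i.1 i.2.1 i.2.2 <= r * i.1%:R].
pose F := filter_from (filter_prod (nbhs t) \oo) A.
have FF : ProperFilter F.
  apply: filter_from_proper.
    apply: filter_from_filter; first by exists setT; exact: filterT.
    move=> P Q hP hQ; exists (P `&` Q); first exact: filterI.
    by move=> i [[? ?] ?].
  move=> Q hQ; apply: contrapT => /set0P/negP/negPn/eqP A0; apply: nfar.
  apply: filterS hQ => -[t' n] Qt x /=; rewrite ltNge; apply/negP => h.
  by have : A Q (n, (t', x)) by []; rewrite A0.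
have F_oo : fst @ F --> \oo.
  move=> N hN; exists (setT `*` N); last by move=> i [[]].
  by exists (setT, N) => //; split => //; exact: filterT.
have F_t : (fun i => i.2.1) @ F --> t.
  move=> N hN; exists (N `*` setT); last by move=> i [[]].
  by exists (N, setT) => //; split => //; exact: filterT.
have [U0 U0t [J JJ hJ]] := limit_joining hD l_ge0 l_lsc FF F_oo F_t y_gen.
have : (m t <= r%:E)%E.
  apply: (@le_trans _ _ (gamma l U0 V)); first by apply: ereal_inf_lbound; exists U0.
  apply: (@le_trans _ _ (\int[J]_z (l (z 0%N))%:E)%E).
    by apply: ereal_inf_lbound; exists J.
  by apply: hJ; exists setT; [exact: filterT|move=> i []].
by rewrite leNgt rm.
Qed.

Section integrable.
Variables (K C : R).
Hypotheses (hf : forall t x, `|f t x| <= K)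
  (l_int : forall u, `|u| <= K -> (\int[V]_v (l (u, v 0%N))%:E <= C%:E)%E).

(** If [m t] were infinite, the total from [point] would almost surely exceed [(C + 1) * n] from
    some time on, while Markov's inequality bounds the probability of this at each time by
    [C / (C + 1)]. Finiteness includes the existence of an invariant measure for [T t]. *)
Lemma min_gamma_lty t : (m t < +oo)%E.
Proof.
rewrite ltey; apply/eqP => mty.
have C0 : 0 <= C.
  rewrite -lee_fin; apply: le_trans (l_int (hf t point)).
  by apply: integral_ge0 => v _; rewrite lee_fin.
have ml u k : measurable_fun setT ((fun v => l (u, v k)) : seqspace R -> R).
  apply: measurableT_comp (lower_semicontinuous_plane_measurable l_lsc) _.
  apply: measurable_fun_pair => //.
  by move=> _ B mB; rewrite setTI; apply: sub_sigma_algebra; exists k, B.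
have mS n : measurable_fun setT ((fun v => total v n t point) : seqspace R -> R).
  by apply: measurable_sum => k; exact: ml.
have int_S n : (\int[V]_v (total v n t point)%:E <= (C * n%:R)%:E)%E.
  rewrite /total; under eq_integral do rewrite -sumEFin.
  rewrite ge0_integral_sum//; last 2 first.
  - by move=> k; apply/measurable_EFinP; exact: ml.
  - by move=> k v _; rewrite lee_fin.
  rewrite -[n in leRHS]card_ord mulr_natr -sumr_const -sumEFin; apply: lee_sum => k _.
  pose phi (v : seqspace R) := (l (f t (iter k (T t) point), v 0%N))%:E.
  apply: le_trans (l_int (hf t (iter k (T t) point))).
  have mphi : measurable_fun setT phi by apply/measurable_EFinP; exact: ml.
  have <- := integral_preserved_iter (@measurable_shift _ R) V_stationary k mphi
    (fun v => l_ge0 _ : (0 <= phi v)%E).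
  rewrite le_eqVlt; apply/orP; left; apply/eqP.
  by apply: eq_integral => v _; rewrite /phi iter_shift addn0.
pose A n : set (seqspace R) := [set v | (C + 1) * n%:R <= total v n t point].
have mA n : measurable (A n).
  by rewrite -[A n]setTI; apply: measurable_fun_le.
have C1 : 0 < C + 1 by rewrite ltr_wpDl.
have total_ge0 v n : 0 <= total v n t point by apply: sumr_ge0.
have VA n : (0 < n)%N -> (V (A n) <= (C / (C + 1))%:E)%E.
  move=> n0; have nr0 : 0 < n%:R :> R by rewrite ltr0n.
  have : (((C + 1) * n%:R)%:E * V (A n) <= (C * n%:R)%:E)%E.
    apply: le_trans (int_S n).
    have <- : (\int[V]_v (\1_(A n) v)%:E = V (A n))%E by rewrite integral_indic// setIT.
    rewrite -ge0_integralZl_EFin//; last 2 first.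
    - by apply/measurable_EFinP; exact: measurable_indic.
    - by rewrite mulr_ge0// ltW.
    apply: ge0_le_integral => //.
    - by move=> v _; rewrite -EFinM lee_fin mulr_ge0// ?indicE// mulr_ge0// ltW.
    - apply: emeasurable_funM => //.
      by apply/measurable_EFinP; exact: measurable_indic.
    - by apply/measurable_EFinP.
    - move=> v _; rewrite -EFinM lee_fin indicE.
      have [/set_mem h|_] := boolP (v \in A n); first by rewrite mulr1.
      by rewrite mulr0.
  have : V (A n) \is a fin_num by exact: fin_num_measure.
  case: (V (A n)) => [q| |]// _; rewrite -EFinM !lee_fin => h.
  rewrite ler_pdivlMr// -(ler_pM2r nr0); lra.
pose E N := \bigcap_(n in [set n | (N <= n)%N]) A n.
have mE N : measurable (E N).
  by apply: bigcap_measurable => //; exists N => /=.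
have mUE : measurable (\bigcup_N E N) by exact: bigcupT_measurable.
have ndE : nondecreasing_seq E.
  move=> N M NM; apply/subsetPset => v h n /= Mn; apply: h.
  exact: leq_trans NM Mn.
have UE1 : V (\bigcup_N E N) = 1%E.
  apply/ae_probability1 => //.
  apply: filterS (ae_generic V_stationary V_ergodic) => y y_gen.
  have [|[P Q] /= [hP [N _ hQ]] hPQ] := @total_near_gt t (C + 1) y y_gen.
    by rewrite mty ltry.
  exists N => // n Nn; apply: ltW; apply: (hPQ (t, n)); split.
    exact: nbhs_singleton.
  exact: hQ.
have cvgE : (fun N => V (E N)) @ \oo --> 1%E.
  by rewrite -UE1; exact: nondecreasing_cvg_mu.
have : (1%E <= (C / (C + 1))%:E :> \bar R)%E.
  rewrite -(cvg_lim _ cvgE)//; apply: lime_le; first by apply/cvg_ex; exists 1%E.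
  apply: nearW => N; apply: le_trans (VA N.+1 isT).
  by apply: le_measure; rewrite ?inE// => v; apply => /=.
by rewrite lee_fin ler_pdivlMr// mul1r gerDl leNgt ltr01.
Qed.

(** One path suffices: orbit segments along a single generic [y], with tolerances shrinking to zero,
    have a limit joining that costs at most every [e j]. *)
Lemma min_gamma_attained t : exists2 U0, processes T f t U0 & gamma l U0 V = m t.
Proof.
have : m t \is a fin_num by rewrite ge0_fin_numE ?min_gamma_lty// min_gamma_ge0.
move=> /fineK; set a := fine _ => aE.
pose e j : R := a + j.+1%:R^-1.
have he : {ae V, forall y : seqspace R, forall j,
    \forall n \near \oo, exists x, total y n t x <= e j * n%:R}.
  apply: ae_foralln => j; apply: total_near_le.
  by rewrite -aE lte_fin ltrDl invr_gt0.
have hg := ae_generic V_stationary V_ergodic.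
have [y [y_gen hy]] := ae_exists (filterI hg he).
pose A j : set (nat * (Theta * X)) :=
  [set i | [/\ (j <= i.1)%N, i.2.1 = t & total y i.1 i.2.1 i.2.2 <= e j * i.1%:R]].
have Asub j k : (j <= k)%N -> A k `<=` A j.
  move=> jk i [ki it h]; split => //; first exact: leq_trans ki.
  apply: le_trans h _; rewrite ler_wpM2r// lerD2l lef_pV2 ?posrE//.
  by rewrite ler_nat ltnS.
pose F := filter_from setT A.
have FF : ProperFilter F.
  apply: filter_from_proper.
    apply: filter_from_filter; first by exists 0%N.
    move=> j k _ _; exists (maxn j k) => // i hi.
    by split; apply: Asub hi; rewrite ?leq_maxl ?leq_maxr.
  move=> j _; have [N _ hN] := hy j.
  have [x hx] := hN (maxn j N) (leq_maxr _ _); pose n := maxn j N.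
  have jn : (j <= n)%N by exact: leq_maxl.
  by exists (n, (t, x)).
have F_oo : fst @ F --> \oo.
  by move=> N [j _ hj]; exists j => // i [ji _ _]; exact: hj.
have F_t : (fun i => i.2.1) @ F --> t.
  by move=> N hN; exists 0%N => // i [_ it _]; rewrite /preimage/= it; exact: nbhs_singleton.
have [U0 U0t [J JJ hJ]] := limit_joining hD l_ge0 l_lsc FF F_oo F_t y_gen.
exists U0 => //; apply/eqP; rewrite eq_le; apply/andP; split; last first.
  by apply: ereal_inf_lbound; exists U0.
apply: (@le_trans _ _ (\int[J]_z (l (z 0%N))%:E)%E).
  by apply: ereal_inf_lbound; exists J.
rewrite -/(m t) -aE; apply/lee_addgt0Pr => d d0.
have [j _ /(_ j (leqnn j)) jd] := near_infty_natSinv_lt (PosNum d0).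
apply: (@le_trans _ _ (e j)%:E).
  by apply: hJ; exists j => // i [].
by rewrite -EFinD lee_fin lerD2l ltW.
Qed.

(** Each parameter of [D] has its own gap above [b], and compactness leaves a single one. The
    covering filter runs over pairs of an index for the gap and a time. *)
Lemma total_near_gt_compact (D : set Theta) (b : R) (y : seqspace R) :
  generic V y -> compact D -> (forall t, D t -> (b%:E < m t)%E) ->
  exists2 r, b < r &
    \forall n \near \oo, forall t x, D t -> r * n%:R < total y n t x.
Proof.
move=> y_gen /compact_near_coveringP cptD Db.
pose e j : R := b + j.+1%:R^-1.
have := cptD _ (filter_prod \oo \oo)
  (fun (i : nat * nat) t => forall x, e i.1 * i.2%:R < total y i.2 t x) _.
case=> [t Dt|[P Q] /= [[j _ hP] hQ] hPQ]; last first.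
  exists (e j); first by rewrite ltrDl invr_gt0.
  apply: filterS hQ => n Qn t x Dt.
  by apply: (hPQ (j, n)) => //; split => //; exact: (hP j (leqnn j)).
have [r br rm] : exists2 r : R, b < r & (r%:E < m t)%E.
  have := Db _ Dt; have := min_gamma_lty t; have := min_gamma_ge0 t.
  rewrite -/(m t); case: (m t) => [c| |]// _ _; rewrite lte_fin => bc.
  by exists ((b + c) / 2); rewrite ?lte_fin midf_lt.
have [[P Q] /= [hP hQ] hPQ] := total_near_gt y_gen rm.
have rb : 0 < r - b by rewrite subr_gt0.
have [j _ /(_ j (leqnn j)) jd] := near_infty_natSinv_lt (PosNum rb).
exists (P, [set k | (j <= k)%N] `*` Q).
  split => //=; exists ([set k | (j <= k)%N], Q) => //; split => //.
  by exists j.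
move=> [t' [k n]] /= [Pt' [jk Qn]] x.
apply: le_lt_trans (hPQ (t', n) _ x); last by split.
rewrite ler_wpM2r// /e -lerBrDl; apply: le_trans (ltW jd).
by rewrite lef_pV2 ?posrE// ler_nat ltnS.
Qed.

(** * Convergence of minimal risks and of near minimizers *)

Let risk y n t := inf [set empirical_risk T f l y n t x | x in [set: X]].

Let empiricalE y n t x : (0 < n)%N ->
  empirical_risk T f l y n t x * n%:R = total y n t x.
Proof. by move=> n0; rewrite /empirical_risk mulrAC mulVf ?mul1r// pnatr_eq0 -lt0n. Qed.

Let empirical_ge0 y n t x : 0 <= empirical_risk T f l y n t x.
Proof. by rewrite mulr_ge0 ?invr_ge0//; apply: sumr_ge0. Qed.

Let risk_ge y n t r : (0 < n)%N -> (forall x, r * n%:R <= total y n t x) ->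
  r <= risk y n t.
Proof.
move=> n0 hr; apply: lb_le_inf; first by exists (empirical_risk T f l y n t point), point.
by move=> _ [x _ <-]; rewrite -(@ler_pM2r _ n%:R) ?ltr0n// empiricalE.
Qed.

Let risk_le y n t x r : (0 < n)%N -> total y n t x <= r * n%:R ->
  risk y n t <= r.
Proof.
move=> n0 hr; apply: le_trans (_ : empirical_risk T f l y n t x <= _).
  by apply: ge_inf; [exists 0 => _ [? _ <-]|exists x].
by rewrite -(@ler_pM2r _ n%:R) ?ltr0n// empiricalE.
Qed.

Let risk_ge0 y n t : 0 <= risk y n t.
Proof.
apply: lb_le_inf; first by exists (empirical_risk T f l y n t point), point.
by move=> _ [x _ <-].
Qed.

Let best y n := inf [set risk y n t | t in [set: Theta]].

Let best_le y n t : best y n <= risk y n t.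
Proof. by apply: ge_inf; [exists 0 => _ [? _ <-]|exists t]. Qed.

Let best_ge y n r : (forall t, r <= risk y n t) -> r <= best y n.
Proof.
by move=> hr; apply: lb_le_inf; [exists (risk y n point), point|move=> _ [t _ <-]].
Qed.

Definition least_cost : R := fine (ereal_inf (range m)).
Local Notation a := least_cost.

Let least_costE : ereal_inf (range m) = a%:E.
Proof.
rewrite /least_cost fineK// ge0_fin_numE.
  apply: le_lt_trans (min_gamma_lty point); apply: ereal_inf_lbound.
  by exists point.
by apply: le_ereal_inf_tmp => _ [t _ <-]; exact: min_gamma_ge0.
Qed.

Let least_cost_le t : (a%:E <= m t)%E.
Proof. by rewrite -least_costE; apply: ereal_inf_lbound; exists t. Qed.

Let optimal := optimal_parameters T f l V.

Lemma optimal_parametersE : optimal = [set t | (m t <= a%:E)%E].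
Proof.
apply/seteqP; split => t /=.
  move=> [_ ht]; rewrite -least_costE; apply: le_ereal_inf_tmp => _ [t' _ <-].
  exact: ht.
move=> mt; split; first exact: min_gamma_attained.
by move=> t'; apply: le_trans mt _; exact: least_cost_le.
Qed.

Let not_optimal t : ~ optimal t -> (a%:E < m t)%E.
Proof. by rewrite optimal_parametersE => /negP; rewrite -ltNge. Qed.

(** The parameter in the upper bound may depend on [r], so a countable family approaching the least
    cost provides it for almost every path. *)
Definition typical (y : seqspace R) := generic V y /\
  forall r, a < r -> exists t, \forall n \near \oo, exists x, total y n t x <= r * n%:R.

Lemma ae_typical : {ae V, forall y, typical y}.
Proof.
have /choice[u_ hu] : forall j : nat, exists t, (m t < (a + j.+1%:R^-1)%:E)%E.
  move=> j; have : (ereal_inf (range m) < (a + j.+1%:R^-1)%:E)%E.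
    by rewrite least_costE lte_fin ltrDl invr_gt0.
  by move=> /ereal_inf_lt [_ [t _ <-] ?]; exists t.
have hy : {ae V, forall y : seqspace R, forall j, \forall n \near \oo,
    exists x, total y n (u_ j) x <= (a + j.+1%:R^-1) * n%:R}.
  by apply: ae_foralln => j; exact: total_near_le.
apply: filterS2 (ae_generic V_stationary V_ergodic) hy => y y_gen hy.
split => // r ar; have ra : 0 < r - a by rewrite subr_gt0.
have [j _ /(_ j (leqnn j)) jd] := near_infty_natSinv_lt (PosNum ra).
exists (u_ j); apply: filterS (hy j) => n [x hx]; exists x; apply: le_trans hx _.
by rewrite ler_wpM2r// -lerBrDl ltW.
Qed.

(** Otherwise compactness of [Theta] would bound all risks below by some [r > a], against the upper
    bound at level [r]. *)
Lemma optimal_nonempty : optimal !=set0.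
Proof.
apply: contrapT => S0; have [y [y_gen hy]] := ae_exists ae_typical.
have cptT : compact [set: Theta] by case: hD.
have [t _|r ar hr] := total_near_gt_compact y_gen cptT (b := a).
  by apply: not_optimal => St; apply: S0; exists t.
have [t ht] := hy r ar.
near \oo => n; have [x] : exists x, total y n t x <= r * n%:R by near: n.
rewrite leNgt => /negP; apply.
have : forall t x, [set: Theta] t -> r * n%:R < total y n t x by near: n.
by apply.
Unshelve. all: by end_near. Qed.

(** Closedness is proved along one path: if [m t > r > a] at a limit [t] of optimal parameters, all
    risks near [t] eventually exceed [r], while some risk at a nearby optimal parameter is at most
    [r]. *)
Lemma optimal_compact : compact optimal.
Proof.
have cptT : compact [set: Theta] by case: hD.
apply: subclosed_compact cptT _ => // t clt.
apply: contrapT => /not_optimal am.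
have [r ar rm] : exists2 r : R, a < r & (r%:E < m t)%E.
  have := am; have := min_gamma_lty t; have := min_gamma_ge0 t.
  rewrite -/(m t); case: (m t) => [c| |]// _ _; rewrite lte_fin => bc.
  by exists ((a + c) / 2); rewrite ?lte_fin midf_lt.
(* The approximating parameters are fixed before the path, since the upper bound
   holds only for almost every path depending on the parameter. *)
have /choice[u_ hu] : forall j : nat, exists u,
    optimal u /\ ball t (j.+1%:R^-1 : R) u.
  move=> j; have [|u [? ?]] := clt (ball t (j.+1%:R^-1 : R)).
    by apply: nbhsx_ballx; rewrite invr_gt0.
  by exists u.
have hy : {ae V, forall y : seqspace R, forall j, \forall n \near \oo,
    exists x, total y n (u_ j) x <= r * n%:R}.
  apply: ae_foralln => j; apply: total_near_le.
  have [+ _] := hu j; rewrite optimal_parametersE => /le_lt_trans; apply.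
  by rewrite lte_fin.
have hg := ae_generic V_stationary V_ergodic.
have [y [y_gen {}hy]] := ae_exists (filterI hg hy).
have [[P Q] /= [hP hQ] hPQ] := total_near_gt y_gen rm.
have /nbhs_ballP[d /= d0 dP] := hP.
have [j _ /(_ j (leqnn j)) jd] := near_infty_natSinv_lt (PosNum d0).
near \oo => n; have [x] : exists x, total y n (u_ j) x <= r * n%:R.
  by near: n; exact: hy.
rewrite leNgt => /negP; apply; apply: (hPQ (u_ j, n)); split => /=; last by near: n.
by apply: dP; apply: le_ball (ltW jd) _ _; have [] := hu j.
Unshelve. all: by end_near. Qed.

Lemma best_cvg y : typical y -> best y @ \oo --> a.
Proof.
move=> [y_gen hy]; apply/cvgrPdist_le => d d0.
have [|t ht] := hy (a + d); first by rewrite ltrDl.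
have cptT : compact [set: Theta] by case: hD.
have [t' _|r ar hr] := total_near_gt_compact y_gen cptT (b := a - d).
  by apply: lt_le_trans (least_cost_le t'); rewrite lte_fin gtrBl.
near=> n; have n0 : (0 < n)%N by near: n; exact: nbhs_infty_gt.
rewrite ler_distl; apply/andP; split.
  rewrite lerBlDr; apply: le_trans (best_le y n t) _.
  have [x] : exists x, total y n t x <= (a + d) * n%:R by near: n.
  exact: risk_le.
rewrite -lerBlDr; apply: best_ge => t'.
apply: risk_ge => // x; apply: ltW.
apply: (@le_lt_trans _ _ (r * n%:R)); first by rewrite ler_wpM2r// ltW.
have : forall t x, [set: Theta] t -> r * n%:R < total y n t x by near: n.
by apply.
Unshelve. all: by end_near. Qed.

(** Parameters at distance at least [d] from the optimal set form a compact set on which [m] exceeds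
    [a]; minimal risks there eventually stay above some [r > a], so [u_] must leave it. *)
Lemma near_minimizers_cvg y (u_ : nat -> Theta) : typical y ->
  (fun n => risk y n (u_ n)) @ \oo --> a -> edist_inf optimal (u_ n) @[n --> \oo] --> 0%E.
Proof.
move=> [y_gen _] u_a.
have near_le d : 0 < d -> \forall n \near \oo, (edist_inf optimal (u_ n) < d%:E)%E.
  move=> d0; pose D := [set t | (d%:E <= edist_inf optimal t)%E].
  have cptD : compact D.
    have cptT : compact [set: Theta] by case: hD.
    apply: subclosed_compact cptT _ => //.
    rewrite /D -[mkset _]/(edist_inf optimal @^-1` [set x | (d%:E <= x)%E]).
    apply: closed_comp => [t _|]; first exact: edist_inf_continuous.
    exact: closed_ereal_le_ereal.
  have [t Dt|r ar hr] := total_near_gt_compact y_gen cptD (b := a).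
    apply: not_optimal => St; move: Dt; rewrite /D /= (edist_inf0 St).
    by rewrite lee_fin leNgt d0.
  near=> n; rewrite ltNge; apply/negP => Dn.
  have n0 : (0 < n)%N by near: n; exact: nbhs_infty_gt.
  have : r <= risk y n (u_ n).
    apply: risk_ge => // x; apply: ltW; move: Dn.
    have : forall t x, D t -> r * n%:R < total y n t x by near: n.
    by apply.
  rewrite leNgt => /negP; apply; near: n.
  exact: (cvgr_lt a u_a).
apply/fine_cvgP; split.
  apply: filterS (near_le 1 ltr01) => n h.
  by rewrite ge0_fin_numE ?edist_inf_ge0//; exact: lt_trans h (ltry _).
apply/cvgrPdist_lt => d d0; apply: filterS (near_le d d0) => n h /=.
have := edist_inf_ge0 optimal (u_ n); move: h; rewrite sub0r normrN.
by case: (edist_inf _ _) => [x| |]//; rewrite !lte_fin lee_fin => ? ?; rewrite ger0_norm.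
Unshelve. all: by end_near. Qed.

Lemma optimal_risk_cvg t : optimal t ->
  {ae V, forall y, risk y n t @[n --> \oo] --> a}.
Proof.
move=> St.
have hy : {ae V, forall y : seqspace R, forall j, \forall n \near \oo,
    exists x, total y n t x <= (a + j.+1%:R^-1) * n%:R}.
  apply: ae_foralln => j; apply: total_near_le.
  move: St; rewrite optimal_parametersE => /le_lt_trans; apply.
  by rewrite lte_fin ltrDl invr_gt0.
apply: filterS2 ae_typical hy => y ty hy; apply/cvgrPdist_le => d d0.
have /cvgrPdist_le/(_ d d0) best_a := best_cvg ty.
have [j _ /(_ j (leqnn j)) jd] := near_infty_natSinv_lt (PosNum d0).
near=> n; have n0 : (0 < n)%N by near: n; exact: nbhs_infty_gt.
have : `|a - best y n| <= d by near: n.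
rewrite !ler_distl => /andP[ba ab]; apply/andP; split.
  rewrite lerBlDr; have [x hx] : exists x, total y n t x <= (a + j.+1%:R^-1) * n%:R.
    by near: n; exact: hy.
  by apply: le_trans (risk_le n0 hx) _; rewrite lerD2l ltW.
by apply: le_trans ab _; rewrite lerD2r best_le.
Unshelve. all: by end_near. Qed.

End integrable.
End minimal_cost.

Theorem theorem2p7 (R : realType) (X Theta : pmetricType R)
    (T : Theta -> X -> X) (f : Theta -> X -> R)
    (hD : continuous_family T f)
    (K : R) (hK : 0 < K) (hf : forall t x, `|f t x| <= K)
    (l : R * R -> R) (l_ge0 : forall z, 0 <= l z)
    (l_lsc : lower_semicontinuous (fun z : R * R => (l z)%:E))
    (d : measure_display) (Omega : measurableType d) (P : probability Omega R)
    (Y : nat -> {RV P >-> R})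
    (Y_stationary : stationary (process_law Y))
    (Y_ergodic : ergodic (process_law Y))
    (Y_integrable :
      (outer_expectation P (fun w =>
         ereal_sup [set (l (u, Y 0%N w))%:E | u in [set u : R | `|u| <= K]%R])
       < +oo)%E) :
  let S := optimal_parameters T f l (process_law Y) in
  [/\ S !=set0,
      compact S,
      (forall theta_ : forall n, n.-tuple R -> Theta,
         min_risk_estimator T f l Y theta_ ->
         {ae P, forall w,
            edist_inf S (estimate Y theta_ w n) @[n --> \oo] --> 0%E}) &
      (forall t, S t ->
         exists2 theta_ : forall n, n.-tuple R -> Theta,
           min_risk_estimator T f l Y theta_ &
           {ae P, forall w, estimate Y theta_ w n @[n --> \oo] --> t})].
Proof.
set V := process_law Y => S.
have path_ae (E : seqspace R -> Prop) :
    {ae V, forall y, E y} -> {ae P, forall w, E (path_of Y w)}.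
  by apply: ae_pushforward => //; exact: measurable_path_of.
(* A measurable majorant of finite integral stands in for the supremum. *)
have [G mG [FG G_fin]] : exists2 G : Omega -> \bar R, measurable_fun setT G &
    (forall w, ereal_sup [set (l (u, Y 0%N w))%:E | u in [set u : R | `|u| <= K]%R] <= G w)%E
    /\ (\int[P]_w G w < +oo)%E.
  by have [_ [G [mG FG] <-] G_fin] := ereal_inf_lt Y_integrable; exists G.
have loss_le u w : `|u| <= K -> ((l (u, Y 0%N w))%:E <= G w)%E.
  move=> uK; apply: le_trans (FG w); apply: ereal_sup_ubound.
  by exists u.
have G0 w : (0 <= G w)%E.
  apply: le_trans (loss_le 0 w _); first by rewrite lee_fin.
  by rewrite normr0 ltW.
have l_int u : `|u| <= K ->
    (\int[V]_v (l (u, v 0%N))%:E <= (fine (\int[P]_w G w))%:E)%E.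
  move=> uK; rewrite fineK; last first.
    by rewrite ge0_fin_numE//; apply: integral_ge0 => w _.
  have ml : measurable_fun setT ((fun v => (l (u, v 0%N))%:E) : seqspace R -> \bar R).
    apply/measurable_EFinP.
    apply: measurableT_comp (lower_semicontinuous_plane_measurable l_lsc) _.
    apply: measurable_fun_pair => //.
    by move=> _ B mB; rewrite setTI; apply: sub_sigma_algebra; exists 0%N, B.
  rewrite /V /process_law ge0_integral_distribution//; last by move=> v; rewrite lee_fin.
  apply: ge0_le_integral => //.
  - by move=> w _; rewrite lee_fin.
  - by apply: measurableT_comp ml _; exact: measurable_path_of.
  - by move=> w _; exact: loss_le.
have typ := ae_typical hD l_ge0 l_lsc Y_stationary Y_ergodic hf l_int.
have typ_w := path_ae _ typ.
split.
- exact: optimal_nonempty l_int.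
- exact: optimal_compact l_int.
- move=> theta_ [_ est]; apply: filterS2 est typ_w => w /= [cl cr clr] tw.
  apply: (near_minimizers_cvg hD l_ge0 l_lsc Y_stationary Y_ergodic hf l_int tw).
  (* The infima over all parameters tend to the least cost, so the defining equality makes the
     estimator a near minimizer. *)
  have := best_cvg hD l_ge0 l_lsc Y_stationary Y_ergodic hf l_int tw.
  by move=> /cvg_lim <-//; rewrite -clr; exact: cl.
(* The constant estimator works, since the minimal risk at an optimal parameter tends almost surely
   to the least cost. *)
- move=> t St; exists (fun _ _ => t); last by apply: aeW => w; exact: cvg_cst.
  split; first by move=> n _; exact: measurable_cst.
  have opt := path_ae _ (optimal_risk_cvg hD l_ge0 l_lsc Y_stationary Y_ergodic hf l_int St).
  apply: filterS2 opt typ_w => w opt_w tw /=.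
  have best_w := best_cvg hD l_ge0 l_lsc Y_stationary Y_ergodic hf l_int tw.
  split; [by apply/cvg_ex; eexists; exact: opt_w|by apply/cvg_ex; eexists; exact: best_w|].
  by rewrite (cvg_lim _ opt_w)// (cvg_lim _ best_w).
Qed.
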